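(* Let $G$ be a compact Lie group acting smoothly on a manifold $M$, and let $\pi:M\to M/G$ be the orbit map, where $M/G$ carries the quotient diffeology. Then $\pi^*$ is an isomorphism from the (diffeological) differential forms on $M/G$ onto the basic differential forms on $M$.
   Context: A parametrisation of a nonempty set $X$ is a function $p:U\to X$ with $U$ an open subset of some $\mathbb{R}^n$. A diffeology $\mathcal{D}$ on $X$ is a set of parametrisations (plots) such that: (1) all constant maps $\mathbb{R}^n\to\{x\}\subseteq X$ ($n\geq 0$, $x\in X$) are in $\mathcal{D}$; (2) a parametrisation that is locally (near each point of its domain) in $\mathcal{D}$ is in $\mathcal{D}$; (3) if $(p:U\to X)\in\mathcal{D}$ and $F:V\to U$ is smooth with $V$ open in some $\mathbb{R}^n$, then $p\circ F\in\mathcal{D}$. A manifold carries the standard diffeology, whose plots are all smooth maps from open subsets of Euclidean spaces. If $\sim$ is an equivalence relation on $X$ with quotient map $\pi:X\to X/{\sim}$, the quotient diffeology on $X/{\sim}$ consists of the parametrisations $p:U\to X/{\sim}$ such that every $u\in U$ has an open neighbourhood $V\subseteq U$ and a plot $q:V\to X$ with $p|_V=\pi\circ q$. A (diffeological) differential $k$-form $\alpha$ on $(X,\mathcal{D})$ assigns to each plot $(p:U\to X)\in\mathcal{D}$ a differential $k$-form $\alpha(p)\in\Omega^k(U)$ such that $\alpha(p\circ F)=F^*(\alpha(p))$ for every smooth map $F:V\to U$, $V$ open in a Euclidean space. The set of these is $\Omega^k(X)$; the wedge product and exterior derivative are defined plotwise, $(\alpha\wedge\beta)(p)=\alpha(p)\wedge\beta(p)$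 and $(d\alpha)(p)=d(\alpha(p))$. If $F:X\to Y$ is diffeologically smooth (i.e. sends plots to plots by composition), $(F^*\alpha)(p)=\alpha(F\circ p)$. On a manifold with its standard diffeology these forms are identified with ordinary differential forms. A form $\alpha$ on $M$ is horizontal if $v\lrcorner\,\alpha=0$ for all $x\in M$ and $v\in T_x(G\cdot x)$; it is basic if it is $G$-invariant and horizontal. *)

(* Defs.v *)
From HB Require Import structures.
From mathcomp Require Import all_boot all_order perm all_algebra.
From mathcomp Require Import all_classical reals topology normedtype landau derive.

Set Implicit Arguments.
Unset Strict Implicit.
Unset Printing Implicit Defensive.

Import Order.TTheory GRing.Theory Num.Theory numFieldNormedType.Exports.

Local Open Scope classical_set_scope.
Local Open Scope quotient_scope.
Local Open Scope ring_scope.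

Section Smooth.
Context {R : realType}.

(* C^k on an open set A, through Frechet differentiability and the directional
   derivatives; meant for finite-dimensional V. *)
Fixpoint Ck {V W : normedModType R} (k : nat) (A : set V) (f : V -> W) : Prop :=
  match k with
  | 0 => forall x, A x -> {for x, continuous f}
  | k'.+1 => (forall x, A x -> differentiable f x) /\
             forall v, Ck k' A ('D_v f)
  end.

Definition smooth_on {V W : normedModType R} (A : set V) (f : V -> W) : Prop :=
  forall k, Ck k A f.

(* Derivatives on an open set A do not see the extension by 0 outside A. *)
Definition smooth {m : nat} {W : normedModType R} {A : set 'rV[R]_m}
    (f : A -> W) : Prop :=
  smooth_on A ('valL_0 f).

Lemma near_eq_differentiable (V W : normedModType R) (f g : V -> W) x :
  (\near x, f x = g x) -> differentiable f x -> differentiable g x.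
Proof.
move=> fg df.
suff dh : differentiable (g - f) x.
  by rewrite -[g](subrK f); apply: differentiableD.
have fgx := nbhs_singleton fg.
have E : (g - f) \o shift x = cst ((g - f) x) + (0 : V -> W) +o_ 0 id.
  apply/eqaddoP => e e0; near=> z.
  rewrite !fctE /= fgx subrr addr0 subr0 (_ : g (z + x) = f (z + x)).
    by rewrite subrr normr0 mulr_ge0// ltW.
  apply/esym; near: z; have := fg; rewrite (near_shift 0 x).
  by apply: filterS => t /=; rewrite subr0.
have d0 : 'd (g - f) x = 0 :> (V -> W).
  by apply/diff_unique => //; exact: cst_continuous.
apply/diff_locallyP; rewrite d0; split => //; exact: cst_continuous.
Unshelve. all: by end_near. Qed.

Lemma Ck_pred (V W : normedModType R) k (A : set V) (f : V -> W) :
  Ck k.+1 A f -> Ck k A f.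
Proof.
elim: k f => [|k IH] f [df Df]; first by move=> x /df/differentiable_continuous.
by split=> // v; exact: IH.
Qed.

Lemma Ck_sub (V W : normedModType R) k (A B : set V) (f : V -> W) :
  A `<=` B -> Ck k B f -> Ck k A f.
Proof.
move=> AB; elim: k f => [|k IH] f /=; first by move=> cf x /AB; exact: cf.
by move=> [df Df]; split=> [x /AB|v]; [exact: df|exact: IH].
Qed.

Lemma Ck_locally (V W : normedModType R) k (A : set V) (f : V -> W) :
  (forall x, A x -> exists2 B : set V, B x & Ck k B f) -> Ck k A f.
Proof.
elim: k f => [|k IH] f H.
  by move=> x /H[B Bx cf]; exact: cf.
split=> [|v]; first by move=> x /H[B Bx [df _]]; exact: df.
by apply: IH => x /H[B Bx [_ Df]]; exists B => //; exact: Df.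
Qed.

Lemma Ck_near (V W : normedModType R) k (A : set V) (f g : V -> W) :
  (forall x, A x -> \near x, f x = g x) -> Ck k A f -> Ck k A g.
Proof.
elim: k f g => [|k IH] f g fg /=.
  move=> cf x Ax; have fgx := fg x Ax.
  rewrite /prop_for /continuous_at -(nbhs_singleton fgx).
  apply: cvg_trans (cf x Ax); apply: near_eq_cvg.
  by apply: filterS fgx => y ->.
move=> [df Df]; split=> [x Ax|v].
  by apply: near_eq_differentiable (df x Ax); exact: fg.
apply: (IH ('D_v f)); last exact: Df.
move=> x /fg/nbhs_interior; apply: filterS => y fgy.
exact: near_eq_derive.
Unshelve. all: by end_near. Qed.

Lemma Ck_eq (V W : normedModType R) k (A : set V) (f g : V -> W) :
  open A -> (forall x, A x -> f x = g x) -> Ck k A f -> Ck k A g.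
Proof.
move=> oA fg; apply: Ck_near => x Ax.
by apply: filterS (open_nbhs_nbhs (conj oA Ax)).
Qed.

Lemma Ck_cst (V W : normedModType R) k (A : set V) (w : W) :
  Ck k A (cst w : V -> W).
Proof.
elim: k w => [|k IH] w /=; first by move=> x _; exact: cst_continuous.
split=> [x _|v]; first exact: differentiable_cst.
rewrite (_ : 'D_v _ = cst 0); first exact: IH.
by apply/funext => x; rewrite derive_cst.
Qed.

Lemma Ck_lin (V W W' : normedModType R) k (A : set V) (h : {linear W -> W'})
    (f : V -> W) : open A ->
  continuous h -> Ck k A f -> Ck k A (h \o f).
Proof.
move=> oA hc; elim: k f => [|k IH] f /=.
  by move=> cf x Ax; apply: continuous_comp; [exact: cf|exact: hc].
move=> [df Df]; split=> [x Ax|v].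
  apply: differentiable_comp; first exact: df.
  exact: linear_differentiable.
apply: (@Ck_eq _ _ _ _ (h \o 'D_v f)) => //; last exact: IH.
move=> x Ax; have dfx := df x Ax; have dh := linear_differentiable (f x) hc.
rewrite /= !deriveE//; last exact: differentiable_comp.
by rewrite (diff_comp dfx dh)/= (diff_lin _ hc).
Qed.

Lemma Ck_id (V : normedModType R) k (A : set V) : Ck k A (id : V -> V).
Proof.
case: k => [|k] /=; first by move=> x _ //.
split=> [x _|v]; first exact: ex_diff.
rewrite (_ : 'D_v _ = cst v); first exact: Ck_cst.
by apply/funext => x; rewrite derive_id.
Qed.

Lemma CkD (V W : normedModType R) k (A : set V) (f g : V -> W) : open A ->
  Ck k A f -> Ck k A g -> Ck k A (f + g).
Proof.
move=> oA; elim: k f g => [|k IH] f g /=.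
  by move=> cf cg x Ax; apply: continuousD; [exact: cf|exact: cg].
move=> [df Df] [dg Dg]; split=> [x Ax|v].
  by apply: differentiableD; [exact: df|exact: dg].
apply: (@Ck_eq _ _ _ _ ('D_v f + 'D_v g)) => //; last exact: IH.
move=> x Ax; rewrite deriveD//; apply: diff_derivable; [exact: df|exact: dg].
Qed.

Lemma Ck_sum (V W : normedModType R) k (A : set V) n (f : 'I_n -> V -> W) :
  open A -> (forall i, Ck k A (f i)) -> Ck k A (\sum_(i < n) f i).
Proof.
move=> oA Hf; elim/big_ind : _ => //; first exact: Ck_cst.
by move=> g h; exact: CkD.
Qed.

Lemma CkM (V : normedModType R) k (A : set V) (f g : V -> R) : open A ->
  Ck k A f -> Ck k A g -> Ck k A (f * g).
Proof.
move=> oA; elim: k f g => [|k IH] f g.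
  by move=> cf cg x Ax; apply: continuousM; [exact: (cf x Ax)|exact: (cg x Ax)].
move=> cf cg; have [df Df] := cf; have [dg Dg] := cg.
split=> [x Ax|v].
  by apply: differentiableM; [exact: df|exact: dg].
apply: (@Ck_eq _ _ _ _ (f * 'D_v g + g * 'D_v f)) => //.
  move=> x Ax; rewrite deriveM//; apply: diff_derivable; [exact: df|exact: dg].
by apply: CkD => //; apply: IH; [exact: Ck_pred|exact: Dg|exact: Ck_pred|exact: Df].
Qed.

Lemma Ck_coord (V : normedModType R) k (A : set V) n (f : V -> 'rV[R]_n) j :
  open A -> Ck k A f -> Ck k A (fun x => f x ord0 j).
Proof.
move=> oA cf.
have lc : linear (fun N : 'rV[R]_n => N ord0 j : R).
  by move=> a u v; rewrite !mxE.
pose cM := GRing.isLinear.Build _ _ _ _ _ lc.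
pose c : {linear 'rV[R]_n -> R} := HB.pack (fun N : 'rV[R]_n => N ord0 j) cM.
by apply: (@Ck_lin _ _ _ _ _ c) => //; exact: coord_continuous.
Qed.

Lemma Ck_comp_scalar m n k (A : set 'rV[R]_m) (B : set 'rV[R]_n)
    (f : 'rV[R]_m -> 'rV[R]_n) (g : 'rV[R]_n -> R) :
  open A -> (forall x, A x -> B (f x)) ->
  Ck k A f -> Ck k B g -> Ck k A (g \o f).
Proof.
move=> oA fAB; elim: k f g fAB => [|k IH] f g fAB.
  by move=> cf cg x Ax; apply: continuous_comp; [exact: (cf x Ax)|exact: (cg _ (fAB x Ax))].
move=> cf cg; have [df Df] := cf; have [dg Dg] := cg.
split=> [x Ax|v].
  by apply: differentiable_comp; [exact: df|exact: (dg _ (fAB x Ax))].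
apply: (@Ck_eq _ _ _ _ (\sum_(j < n) ((fun x => 'D_v f x ord0 j) *
    ('D_(delta_mx 0 j) g \o f)))) => //.
  move=> x Ax; have dfx := df x Ax; have dgx := dg _ (fAB _ Ax).
  rewrite [RHS]deriveE; last exact: differentiable_comp.
  rewrite (diff_comp dfx dgx)/= -(deriveE _ dfx) [X in 'd g _ X]row_sum_delta linear_sum.
  rewrite fct_sumE; apply: eq_bigr => j _.
  by rewrite linearZ -deriveE.
apply: Ck_sum => // j; apply: CkM => //.
  by apply: Ck_coord => //; exact: Df.
by apply: IH => //; [exact: Ck_pred|exact: Dg].
Qed.

Lemma Ck_rV (V : normedModType R) k (A : set V) n (f : V -> 'rV[R]_n) :
  open A -> (forall j, Ck k A (fun x => f x ord0 j)) -> Ck k A f.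
Proof.
move=> oA Hf.
rewrite (_ : f = \sum_(j < n)
    (fun x => f x ord0 j *: (delta_mx 0 j : 'rV[R]_n))); last first.
  by apply/funext => x; rewrite fct_sumE [LHS]row_sum_delta.
apply: Ck_sum => // j.
have ls : linear ( *:%R^~ (delta_mx 0 j : 'rV[R]_n) : R -> 'rV[R]_n).
  by move=> a u v; rewrite scalerDl scalerA.
pose sM := GRing.isLinear.Build _ _ _ _ _ ls.
pose c : {linear R -> 'rV[R]_n} :=
  HB.pack ( *:%R^~ (delta_mx 0 j : 'rV[R]_n)) sM.
apply: (@Ck_lin _ _ _ _ _ c (fun x => f x ord0 j)) => //.
exact: scalel_continuous.
Qed.

Lemma smooth_on_comp m n p (A : set 'rV[R]_m) (B : set 'rV[R]_n)
    (f : 'rV[R]_m -> 'rV[R]_n) (g : 'rV[R]_n -> 'rV[R]_p) :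
  open A -> (forall x, A x -> B (f x)) -> open B ->
  smooth_on A f -> smooth_on B g -> smooth_on A (g \o f).
Proof.
move=> oA fAB oB sf sg k; apply: Ck_rV => // j.
apply: (@Ck_comp_scalar _ _ _ _ B _ (fun y => g y ord0 j)) => //.
by apply: Ck_coord => //; exact: sg.
Qed.

End Smooth.

Section OpenSets.
Context {R : realType}.

Definition subset_incl {T : Type} {A B : set T} (AB : A `<=` B) (a : A) : B :=
  SigSub (mem_set (AB _ (set_valP a))).

Definition alternating_multilinear {k n : nat} (w : 'M[R]_(k, n) -> R) : Prop :=
  (forall (i : 'I_k) (a : R) (A B C : 'M[R]_(k, n)),
     row i A = a *: row i B + row i C ->
     row' i B = row' i A -> row' i C = row' i A ->
     w A = a * w B + w C) /\
  (forall (A : 'M[R]_(k, n)) (i j : 'I_k),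
     i != j -> row i A = row j A -> w A = 0).

(* The rows of A : 'M_(k, n) are the k vectors to which a form is applied. *)
Definition covector_field {n : nat} (U : set 'rV[R]_n) (k : nat) : Type :=
  U -> 'M[R]_(k, n) -> R.

Definition kforms {n : nat} (U : set 'rV[R]_n) (k : nat) : set (covector_field U k) :=
  [set w | (forall u, alternating_multilinear (w u)) /\
           (forall A, smooth (fun u => w u A))].

Definition local_pullback {m n k : nat} {V : set 'rV[R]_m} {U : set 'rV[R]_n}
    (F : V -> U) (w : covector_field U k) : covector_field V k :=
  fun v A => w (F v) (A *m 'J ('valL_0 (\val \o F)) (\val v)).

(* (a /\ b)(v_1 .. v_{k+l}) =
   1/(k! l!) sum_s sgn(s) a(v_s(1) .. v_s(k)) b(v_s(k+1) .. v_s(k+l)) *)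
Definition local_wedge {n k l : nat} {U : set 'rV[R]_n}
    (a : covector_field U k) (b : covector_field U l) : covector_field U (k + l) :=
  fun u A => (k`! * l`!)%:R^-1 *
    \sum_(s : 'S_(k + l)) (-1) ^+ s *
      (a u (usubmx (row_perm s A)) * b u (dsubmx (row_perm s A))).

(* (dw)(v_0 .. v_k) = sum_i (-1)^i D_{v_i} (w (v_0 .. v_{i-1} v_{i+1} .. v_k)) *)
Definition local_d {n k : nat} {U : set 'rV[R]_n} (w : covector_field U k) :
    covector_field U k.+1 :=
  fun u A => \sum_(i < k.+1) (-1) ^+ i *
    'D_(row i A) ('valL_0 (fun u' : U => w u' (row' i A))) (\val u).

(* Interior product at a point: v is inserted in the first slot. *)
Definition interior_product {n : nat} (k : nat) (v : 'rV[R]_n) :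
    ('M[R]_(k, n) -> R) -> 'M[R]_(k.-1, n) -> R :=
  match k with
  | 0 => fun _ _ => 0
  | k'.+1 => fun w B => w (col_mx v B)
  end.

End OpenSets.
Arguments kforms {R n} U k _.

Section Diffeology.
Context {R : realType}.

Record diffeology (X : Type) := Diffeology {
  is_plot : forall n (U : set 'rV[R]_n), (U -> X) -> Prop;
  plot_open : forall n (U : set 'rV[R]_n) (p : U -> X), is_plot p -> open U;
  plot_cst : forall n (x : X), is_plot (fun _ : [set: 'rV[R]_n] => x);
  plot_local : forall n (U : set 'rV[R]_n) (p : U -> X), open U ->
    (forall u : U, exists (V : set 'rV[R]_n) (VU : V `<=` U),
       [/\ open V, V (\val u) & is_plot (p \o subset_incl VU)]) ->
    is_plot p;
  plot_comp : forall m n (V : set 'rV[R]_m) (U : set 'rV[R]_n)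
    (p : U -> X) (F : V -> U),
    is_plot p -> open V -> smooth (\val \o F) -> is_plot (p \o F) }.

Record plot (X : Type) (D : diffeology X) := Plot {
  pdim : nat;
  pdom : set 'rV[R]_pdim;
  pmap :> pdom -> X;
  plotP : is_plot D pmap }.
Arguments pdom {X D} p.
Arguments pmap {X D} p.

Record dmap (X Y : Type) (DX : diffeology X) (DY : diffeology Y) := DMap {
  dfun :> X -> Y;
  dmapP : forall n (U : set 'rV[R]_n) (p : U -> X),
    is_plot DX p -> is_plot DY (dfun \o p) }.

Definition push_plot (X Y : Type) (DX : diffeology X) (DY : diffeology Y)
    (F : dmap DX DY) (p : plot DX) : plot DY :=
  Plot (dmapP F (plotP p)).

Definition plotwise (X : Type) (D : diffeology X) (k : nat) : Type :=
  forall p : plot D, covector_field (pdom p) k.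

Definition dforms (X : Type) (D : diffeology X) (k : nat) :
    set (plotwise D k) :=
  [set w : plotwise D k | (forall p : plot D, kforms (pdom p) k (w p)) /\
    (forall (p q : plot D) (F : pdom q -> pdom p), smooth (\val \o F) ->
       pmap q = pmap p \o F -> w q = local_pullback F (w p))].

Definition form_pullback (X Y : Type) (DX : diffeology X) (DY : diffeology Y)
    (F : dmap DX DY) (k : nat) (w : plotwise DY k) : plotwise DX k :=
  fun p => w (push_plot F p).

Definition form_lincomb (X : Type) (D : diffeology X) (k : nat)
    (c : R) (a b : plotwise D k) : plotwise D k :=
  fun p u A => c * a p u A + b p u A.

Definition form_wedge (X : Type) (D : diffeology X) (k l : nat)
    (a : plotwise D k) (b : plotwise D l) : plotwise D (k + l) :=
  fun p => local_wedge (a p) (b p).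

Definition form_d (X : Type) (D : diffeology X) (k : nat) (w : plotwise D k) :
    plotwise D k.+1 :=
  fun p => local_d (w p).

End Diffeology.
Arguments dforms {R X} D k.
Arguments plotwise {R X} D k.
Arguments plot {R X} D.

Section SetTypeFacts.
Context {R : realType}.

Lemma valL0E m (W : normedModType R) (A : set 'rV[R]_m) (f : A -> W) (a : A) :
  'valL_0 f (\val a) = f a.
Proof. by rewrite -[in RHS](valLK 0 f). Qed.

Lemma imval_pre (T : Type) (A : set T) (Y : Type) (f : A -> Y) (B : set Y) x :
  (\val @` (f @^-1` B)) x <-> exists2 u : A, \val u = x & B (f u).
Proof. by split=> [[u Bu <-]|[u <- Bu]]; exists u. Qed.

Lemma open_imval (T : topologicalType) (A : set T) (B : set A) :
  open A -> open B <-> open (\val @` B).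
Proof.
move=> oA; split=> [[W oW <-]|oB].
  rewrite (_ : _ @` _ = A `&` W); first exact: openI.
  apply/seteqP; split=> [_ [u Wu <-]|x [Ax Wx]].
    by split=> //; exact: set_valP.
  by exists (exist _ x (mem_set Ax)).
exists (\val @` B) => //; apply/seteqP; split=> [u [v Bv /val_inj <-]|u Bu]//.
by exists u.
Qed.

Lemma open_preimage_at (T S : topologicalType) (A : set T) (g : T -> S)
    (W : set S) :
  open A -> (forall x, A x -> {for x, continuous g}) -> open W ->
  open (A `&` g @^-1` W).
Proof.
move=> oA cg oW; rewrite openE => x [Ax Wx].
apply: filterI; first exact: open_nbhs_nbhs.
by apply: (cg x Ax); exact: open_nbhs_nbhs.
Qed.

Lemma smooth_incl m (W : normedModType R) (A B : set 'rV[R]_m) (AB : A `<=` B)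
    (f : B -> W) : open A -> smooth f -> smooth (f \o subset_incl AB).
Proof.
move=> oA sf k; apply: (@Ck_eq _ _ _ _ _ ('valL_0 f)) => //.
  move=> x Ax; rewrite -[x]/(\val (exist _ x (mem_set Ax) : A)) valL0E /=.
  by rewrite -(valL0E f).
by apply: Ck_sub (sf k).
Qed.

Lemma smooth_continuous m n (V : set 'rV[R]_m) (U : set 'rV[R]_n) (F : V -> U) :
  open V -> smooth (\val \o F) -> continuous F.
Proof.
move=> oV sF; apply/continuousP => B [W oW <-].
apply/(open_imval _ oV).
rewrite (_ : _ @` _ = V `&` 'valL_0 (\val \o F) @^-1` W).
  by apply: open_preimage_at => //; exact: (sF 0%N).
apply/seteqP; split=> [_ [v Wv <-]|x [Vx]].
  by split; [exact: set_valP|rewrite /preimage/mkset valL0E].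
rewrite /preimage/mkset -[x]/(\val (exist _ x (mem_set Vx) : V)) valL0E => Wx.
by exists (exist _ x (mem_set Vx)).
Qed.

End SetTypeFacts.

Section Quotient.
Context {R : realType} {T : Type} (D : diffeology (R := R) T) (Q : quotType T).

Definition quotient_plot n (U : set 'rV[R]_n) (p : U -> Q) : Prop :=
  open U /\
  forall u : U, exists (V : set 'rV[R]_n) (VU : V `<=` U),
    [/\ open V, V (\val u) &
        exists2 q : V -> T, is_plot D q & p \o subset_incl VU = \pi_Q \o q].

Lemma quotient_plot_cst n (x : Q) :
  quotient_plot (fun _ : [set: 'rV[R]_n] => x).
Proof.
split; first exact: openT.
move=> u; exists setT, (@subsetT _ _); split=> //; first exact: openT.
exists (fun _ => repr x); first exact: plot_cst.
by apply/funext => v /=; rewrite reprK.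
Qed.

Lemma quotient_plot_local n (U : set 'rV[R]_n) (p : U -> Q) : open U ->
  (forall u : U, exists (V : set 'rV[R]_n) (VU : V `<=` U),
     [/\ open V, V (\val u) & quotient_plot (p \o subset_incl VU)]) ->
  quotient_plot p.
Proof.
move=> oU H; split=> // u; have [V [VU [oV Vu [_ pV]]]] := H u.
have [W [WV [oW Wu [q qP qE]]]] := pV (exist _ (\val u) (mem_set Vu)).
exists W, (subset_trans WV VU); split=> //; exists q => //.
by rewrite -qE; apply/funext => w /=; congr p; exact: val_inj.
Qed.

Lemma quotient_plot_comp m n (V : set 'rV[R]_m) (U : set 'rV[R]_n)
    (p : U -> Q) (F : V -> U) :
  quotient_plot p -> open V -> smooth (\val \o F) -> quotient_plot (p \o F).
Proof.
move=> [oU pP] oV sF; split=> // v.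
have [W [WU [oW WFv [q qP qE]]]] := pP (F v).
pose V' := V `&` 'valL_0 (\val \o F) @^-1` W.
have oV' : open V' by apply: open_preimage_at => //; exact: (sF 0%N).
have V'V : V' `<=` V by move=> x [].
have FW (x : V') : W (\val (F (subset_incl V'V x))).
  have [_] := set_valP x.
  by rewrite /preimage/mkset -[\val x]/(\val (subset_incl V'V x)) valL0E.
exists V', V'V; split=> //.
  by split; [exact: set_valP|rewrite /preimage/mkset valL0E].
pose F' (x : V') : W := SigSub (mem_set (FW x)).
exists (q \o F'); first by apply: (plot_comp qP oV'); exact: (smooth_incl V'V oV' sF).
rewrite compA -qE; apply/funext => x /=; congr p; exact: val_inj.
Qed.

Definition quotient_diffeology : diffeology (R := R) Q :=
  @Diffeology R Q quotient_plot (fun _ _ _ => @proj1 _ _)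
    quotient_plot_cst quotient_plot_local quotient_plot_comp.

Lemma pi_dmapP n (U : set 'rV[R]_n) (p : U -> T) :
  is_plot D p -> is_plot quotient_diffeology (\pi_Q \o p).
Proof.
move=> pP; have oU := plot_open pP; split=> // u.
exists U, (@subset_refl _ U); split=> //; first exact: set_valP.
exists p => //; apply/funext => v /=; congr (\pi_Q (p _)); exact: val_inj.
Qed.

Definition pi_dmap : dmap D quotient_diffeology := DMap pi_dmapP.

End Quotient.

(* A bare join: continuity of the operations is part of lie_group below. *)
#[short(type="groupTopologicalType")]
HB.structure Definition GroupTopological := {G of Topological G & Group G}.

Section Manifolds.
Context {R : realType}.

(* A homeomorphism from the open set cdom of M to the open set cimg of R^d, with
   inverse cinv; the values of cmap off cdom and of cinv off cimg are junk. *)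
Record chart (M : topologicalType) (d : nat) := Chart {
  cdom : set M;
  cimg : set 'rV[R]_d;
  cmap : M -> 'rV[R]_d;
  cinv : 'rV[R]_d -> M;
  cdom_open : open cdom;
  cimg_open : open cimg;
  cmap_img : forall x, cdom x -> cimg (cmap x);
  cinv_dom : forall y, cimg y -> cdom (cinv y);
  cmapK : forall x, cdom x -> cinv (cmap x) = x;
  cinvK : forall y, cimg y -> cmap (cinv y) = y;
  cmap_continuous : {within cdom, continuous cmap};
  cinv_continuous : {within cimg, continuous cinv} }.

Record smooth_manifold (M : topologicalType) := SmoothManifold {
  mdim : nat;
  atlas : set (chart M mdim);
  manifold_hausdorff : hausdorff_space M;
  manifold_second_countable : @second_countable M;
  atlas_cover : forall x : M, exists2 c, atlas c & cdom c x;
  atlas_compat : forall b c, atlas b -> atlas c ->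
    smooth_on [set y | cimg b y /\ cdom c (cinv b y)] (cmap c \o cinv b) }.

Definition smooth_map (M N : topologicalType) (SM : smooth_manifold M)
    (SN : smooth_manifold N) (f : M -> N) : Prop :=
  continuous f /\
  forall b c, atlas (s := SM) b -> atlas (s := SN) c ->
    smooth_on [set y | cimg b y /\ cdom c (f (cinv b y))]
              (cmap c \o f \o cinv b).

(* Smoothness of f : N1 x N2 -> P in product charts, R^n1 x R^n2 being
   identified with 'rV_(n1 + n2). *)
Definition smooth_map2 (N1 N2 P : topologicalType) (S1 : smooth_manifold N1)
    (S2 : smooth_manifold N2) (SP : smooth_manifold P) (f : N1 -> N2 -> P) :
    Prop :=
  continuous (fun z : N1 * N2 => f z.1 z.2) /\
  forall b1 b2 c,
    atlas (s := S1) b1 -> atlas (s := S2) b2 -> atlas (s := SP) c ->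
    smooth_on
      [set z : 'rV[R]_(mdim S1 + mdim S2) |
         [/\ cimg b1 (lsubmx z), cimg b2 (rsubmx z) &
             cdom c (f (cinv b1 (lsubmx z)) (cinv b2 (rsubmx z)))]]
      (fun z => cmap c (f (cinv b1 (lsubmx z)) (cinv b2 (rsubmx z)))).

Section StandardDiffeology.
Context (M : topologicalType) (SM : smooth_manifold M).

(* Smooth maps from the open submanifold U of R^n to M. *)
Definition std_plot n (U : set 'rV[R]_n) (p : U -> M) : Prop :=
  [/\ open U, continuous p &
      forall c, atlas (s := SM) c ->
        smooth_on (\val @` (p @^-1` cdom c)) ('valL_0 (cmap c \o p))].

Lemma std_plot_cst n (x : M) : std_plot (fun _ : [set: 'rV[R]_n] => x).
Proof.
split; [exact: openT|exact: cst_continuous|move=> c _ k].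
rewrite (_ : 'valL_0 _ = cst (cmap c x)); first exact: Ck_cst.
apply/funext => y.
by rewrite -[y]/(\val (exist _ y (mem_set I) : [set: 'rV[R]_n])) valL0E.
Qed.

Lemma std_plot_open n (U : set 'rV[R]_n) (p : U -> M) (W : set M) :
  open U -> continuous p -> open W -> open (\val @` (p @^-1` W)).
Proof.
move=> oU cp oW; apply/(open_imval _ oU).
by move/continuousP: cp; exact.
Qed.

Lemma std_plot_local n (U : set 'rV[R]_n) (p : U -> M) : open U ->
  (forall u : U, exists (V : set 'rV[R]_n) (VU : V `<=` U),
     [/\ open V, V (\val u) & std_plot (p \o subset_incl VU)]) ->
  std_plot p.
Proof.
move=> oU H; split=> //.
  apply/continuousP => W oW; apply/(open_imval _ oU).
  rewrite openE => _ [u Wu <-].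
  have [V [VU [oV Vu [_ cq _]]]] := H u.
  have oVW := std_plot_open oV cq oW.
  apply: (@filterS _ _ _ (\val @` ((p \o subset_incl VU) @^-1` W))).
    by move=> _ [v Wv <-]; exists (subset_incl VU v).
  apply: open_nbhs_nbhs; split=> //.
  exists (SigSub (mem_set Vu)) => //.
  by move: Wu; rewrite /preimage/=; congr (W (p _)); exact: val_inj.
move=> c ac k; apply: Ck_locally => _ [u cu <-].
have [V [VU [oV Vu [_ cq sq]]]] := H u.
exists (\val @` ((p \o subset_incl VU) @^-1` cdom c)).
  exists (SigSub (mem_set Vu)) => //.
  by move: cu; rewrite /preimage/=; congr (cdom c (p _)); exact: val_inj.
apply: (Ck_eq _ _ (sq c ac k)); first exact: std_plot_open (cdom_open c).
move=> _ [v _ <-]; rewrite valL0E.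
by rewrite -[\val v]/(\val (subset_incl VU v)) valL0E.
Qed.

Lemma std_plot_comp m n (V : set 'rV[R]_m) (U : set 'rV[R]_n)
    (p : U -> M) (F : V -> U) :
  std_plot p -> open V -> smooth (\val \o F) -> std_plot (p \o F).
Proof.
move=> [oU cp sp] oV sF; have cF := smooth_continuous oV sF.
have cpF : continuous (p \o F).
  by move=> v; apply: continuous_comp; [exact: cF|exact: cp].
split=> // c ac k.
have oA := std_plot_open oV cpF (cdom_open c).
have oB := std_plot_open oU cp (cdom_open c).
have valF (v : V) : 'valL_0 (\val \o F) (\val v) = \val (F v).
  by rewrite valL0E.
apply: (@Ck_eq _ _ _ _ _
  ('valL_0 (cmap c \o p) \o 'valL_0 (\val \o F))) => //.
  by move=> _ [v _ <-]; rewrite /comp valF !valL0E.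
apply: (smooth_on_comp oA _ oB _ (sp c ac)).
  by move=> _ [v cv <-]; rewrite valF; exists (F v).
by move=> k'; apply: Ck_sub (sF k') => _ [v _ <-]; exact: set_valP.
Qed.

Definition std_diffeology : diffeology (R := R) M :=
  @Diffeology R M std_plot (fun _ _ _ h => let: And3 o _ _ := h in o)
    std_plot_cst std_plot_local std_plot_comp.

Lemma chart_plotP c :
  atlas (s := SM) c -> is_plot std_diffeology (sigL (cimg c) (cinv c)).
Proof.
move=> ac; have oc : open (cimg c) := @cimg_open _ _ c.
have cc : continuous (sigL (cimg c) (cinv c)).
  by apply/subspace_sigL_continuousP; exact: cinv_continuous.
split=> // b ab k; have oA := std_plot_open oc cc (cdom_open b).
apply: (@Ck_eq _ _ _ _ _ (cmap b \o cinv c)) => //.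
  by move=> _ [v _ <-]; rewrite valL0E.
by apply: Ck_sub (atlas_compat ac ab k) => _ [v bv <-]; split=> //; exact: set_valP.
Qed.

Definition chart_plot c (ac : atlas (s := SM) c) : plot std_diffeology :=
  Plot (chart_plotP ac).

End StandardDiffeology.

End Manifolds.
Arguments atlas {R M} s _.

Section Actions.
Context {R : realType}.

Record lie_group (G : groupTopologicalType) := LieGroup {
  lie_manifold :> smooth_manifold (R := R) G;
  lie_mul_smooth :
    smooth_map2 lie_manifold lie_manifold lie_manifold (fun g h : G => (g * h)%g);
  lie_inv_smooth : smooth_map lie_manifold lie_manifold (fun g : G => (g^-1)%g) }.

Record smooth_action (G : groupTopologicalType) (LG : lie_group G)
    (M : topologicalType) (SM : smooth_manifold (R := R) M) := SmoothAction {
  act_fun :> G -> M -> M;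
  act_one : forall x, act_fun 1%g x = x;
  act_mul : forall g h x, act_fun (g * h)%g x = act_fun g (act_fun h x);
  act_smooth : smooth_map2 LG SM SM act_fun }.

Context (G : groupTopologicalType) (LG : lie_group G).
Context (M : topologicalType) (SM : smooth_manifold (R := R) M).
Context (a : smooth_action LG SM).

Definition same_orbit (x y : M) : bool := `[< exists g : G, y = a g x >].

Lemma same_orbit_equiv : equiv_class_of same_orbit.
Proof.
split.
- by move=> x; apply/asboolP; exists 1%g; rewrite act_one.
- suff H x y : same_orbit x y -> same_orbit y x.
    by move=> x y; apply/idP/idP; exact: H.
  move=> /asboolP[g ->]; apply/asboolP; exists (g^-1)%g.
  by rewrite -act_mul mulVg act_one.
- move=> y x z /asboolP[g ->] /asboolP[h ->]; apply/asboolP; exists (h * g)%g.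
  by rewrite act_mul.
Qed.

Canonical same_orbit_equiv_rel := EquivRelPack same_orbit_equiv.

Definition orbit_space := {eq_quot same_orbit}.

Definition orbit_diffeology : diffeology (R := R) orbit_space :=
  quotient_diffeology (std_diffeology SM) orbit_space.

Definition orbit_map : dmap (std_diffeology SM) orbit_diffeology :=
  pi_dmap (std_diffeology SM) orbit_space.

Lemma act_plotP (g : G) n (U : set 'rV[R]_n) (p : U -> M) :
  is_plot (std_diffeology SM) p -> is_plot (std_diffeology SM) (a g \o p).
Proof.
move=> [oU cp sp]; have [ca sa] := act_smooth a.
have cag : continuous (a g).
  move=> x; apply: (@continuous_comp _ _ _ (fun y => (g, y))
    (fun z : G * M => a z.1 z.2)); last exact: ca.
  by apply: cvg_pair => /=; [exact: cvg_cst|exact: cvg_id].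
have cgp : continuous (a g \o p).
  by move=> u; apply: continuous_comp; [exact: cp|exact: cag].
split=> // c ac k; apply: Ck_locally => _ [u cu <-].
have [b ab bg] := atlas_cover LG g.
have [d ad du] := atlas_cover SM (p u).
set C := \val @` ((a g \o p) @^-1` cdom c).
set B := \val @` (p @^-1` cdom d).
have oC : open C := std_plot_open oU cgp (cdom_open c).
have oB : open B := std_plot_open oU cp (cdom_open d).
exists (C `&` B); first by split; exists u.
have oCB : open (C `&` B) by exact: openI.
pose H (z : 'rV[R]_(mdim LG + mdim SM)) :=
  cmap c (a (cinv b (lsubmx z)) (cinv d (rsubmx z))).
pose K x : 'rV[R]_(mdim LG + mdim SM) :=
  row_mx (cmap b g) ('valL_0 (cmap d \o p) x).
pose E := [set z : 'rV[R]_(mdim LG + mdim SM) |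
         [/\ cimg b (lsubmx z), cimg d (rsubmx z) &
             cdom c (a (cinv b (lsubmx z)) (cinv d (rsubmx z)))]].
have KE (w : U) : cdom d (p w) -> H (K (\val w)) = cmap c (a g (p w)).
  by move=> dw; rewrite /H /K valL0E row_mxKl row_mxKr cmapK// cmapK.
have oE : open E.
  pose E0 := [set z : 'rV[R]_(mdim LG + mdim SM) | cimg b (lsubmx z)] `&`
    [set z : 'rV[R]_(mdim LG + mdim SM) | cimg d (rsubmx z)].
  have oE0 : open E0.
    apply: openI.
      by apply: open_comp; [move=> z _; exact: continuous_lsubmx|exact: cimg_open].
    by apply: open_comp; [move=> z _; exact: continuous_rsubmx|exact: cimg_open].
  rewrite (_ : E = E0 `&` (fun z => a (cinv b (lsubmx z)) (cinv d (rsubmx z)))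
      @^-1` cdom c); last first.
    by apply/seteqP; split=> [z [bz dz cz]|z [[bz dz] cz]].
  apply: open_preimage_at; [exact: oE0| |exact: cdom_open].
  move=> z [bz dz].
  have cb : {for lsubmx z, continuous (cinv b)}.
    have := @cinv_continuous _ _ _ b.
    by rewrite (continuous_open_subspace _ (@cimg_open _ _ _ b)); apply; rewrite inE.
  have cd : {for rsubmx z, continuous (cinv d)}.
    have := @cinv_continuous _ _ _ d.
    by rewrite (continuous_open_subspace _ (@cimg_open _ _ _ d)); apply; rewrite inE.
  have cl : {for z, continuous (fun z => cinv b (lsubmx z))}.
    by apply: (@continuous_comp _ _ _ (@lsubmx R 1 (mdim LG) (mdim SM)) (cinv b));
      [exact: continuous_lsubmx|exact: cb].
  have cr : {for z, continuous (fun z => cinv d (rsubmx z))}.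
    by apply: (@continuous_comp _ _ _ (@rsubmx R 1 (mdim LG) (mdim SM)) (cinv d));
      [exact: continuous_rsubmx|exact: cd].
  apply: (@continuous_comp _ _ _
    (fun z => (cinv b (lsubmx z), cinv d (rsubmx z)))
    (fun z : G * M => a z.1 z.2)); last exact: ca.
  exact: (cvg_pair cl cr).
apply: (@Ck_eq _ _ _ _ _ (H \o K)) => //.
  move=> x [_ [w dw xw]]; rewrite -xw.
  by rewrite valL0E /comp KE.
apply: (smooth_on_comp oCB _ oE _ (sa _ _ _ ab ad ac)).
  move=> x [[w cw xw] [w' dw xw']]; have ww' : w = w'.
    by apply: val_inj; rewrite xw xw'.
  subst w'; rewrite /E /= /K -xw valL0E row_mxKl row_mxKr.
  by split; [exact: cmap_img|exact: cmap_img|rewrite !cmapK].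
move=> k'; apply: Ck_rV => // j; rewrite /K.
case: (splitP j) => i ji.
  rewrite (_ : (fun x => _) = cst (cmap b g ord0 i)); first exact: Ck_cst.
  apply/funext => x; rewrite (_ : j = lshift _ i) ?row_mxEl//; exact: val_inj.
rewrite (_ : (fun x => _) = (fun x => 'valL_0 (cmap d \o p) x ord0 i)).
  by apply: Ck_coord => //; apply: Ck_sub (sp d ad k') => x [].
apply/funext => x; rewrite (_ : j = rshift _ i) ?row_mxEr//; exact: val_inj.
Qed.

Definition act_dmap (g : G) : dmap (std_diffeology SM) (std_diffeology SM) :=
  DMap (act_plotP g).

Definition invariant_form k (w : plotwise (std_diffeology SM) k) : Prop :=
  forall g : G, form_pullback (act_dmap g) w = w.

(* T_x(G.x), the image of T_1 G under the differential at 1 of g |-> g.x, in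
   the coordinates of a chart c of M at x; T_1 G is R^(mdim LG) in a chart b
   of G at 1. *)
Definition orbit_tangent (x : M) (c : chart M (mdim SM)) : set 'rV[R]_(mdim SM) :=
  [set v | exists b, [/\ atlas LG b, cdom b 1%g &
     exists w, v = 'D_w (cmap c \o (fun g => a g x) \o cinv b) (cmap b 1%g)]].

(* In the chart c, the form w is the ordinary form w (chart_plot ac) on the
   open set cimg c. *)
Definition horizontal k (w : plotwise (std_diffeology SM) k) : Prop :=
  forall c (ac : atlas SM c) (u : cimg c) (v : 'rV[R]_(mdim SM)),
    orbit_tangent (cinv c (\val u)) c v ->
    interior_product v (w (chart_plot ac) u) = (fun=> 0).

Definition basic_forms k : set (plotwise (std_diffeology SM) k) :=
  [set w | [/\ dforms (std_diffeology SM) k w, invariant_form w & horizontal w]].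

End Actions.
Arguments basic_forms {R G LG M SM} a k _.
Arguments lie_group R G : clear implicits.
Arguments smooth_manifold R M : clear implicits.

(* Main.v *)
Require Import Defs.
From HB Require Import structures.
From mathcomp Require Import all_boot all_order perm all_algebra.
From mathcomp Require Import all_classical reals topology normedtype landau derive.
From mathcomp Require Import ring lra.

(** The pullback along the orbit map pi is injective because every plot of M/G
    lifts locally to M. A form pi^* beta is invariant because pi (g x) = pi x,
    and horizontal because the maps (g, x) |-> g x and (g, x) |-> x have the same
    composite with pi. Linearity, and compatibility with the wedge product and
    the exterior derivative, hold by definition, since all operations are
    plotwise.

    The substance is surjectivity. A basic form alpha should descend to M/G by
    being evaluated on local lifts, and this is consistent provided that
    p^* alpha = q^* alpha for any two plots p, q : U -> M with pi p = pi q
    ([basic_form_lift_eq]). Both sides are smooth, so it is enough to compare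
    them at a dense set of points u. At u it is enough to find h in G such that
    h q(u) = p(u) and such that the differentials of h q and p at u agree modulo
    vectors tangent to the orbit, by invariance and horizontality of alpha.
    [generic_lift_point] finds such a point in each nonempty open set, in a way
    that requires neither a slice theorem nor an implicit function theorem.

    First, U is shrunk around a point where the dimension of the orbit of p(u)
    is maximal. Compactness of G and a finite Baire argument then give an open
    set on which, after translating q, one has q(u) = g_u p(u) with all g_u close
    to 1 and q(u1) = p(u1) for a point u1. The element g_u is determined only
    modulo the stabilizer of p(u), and can be much larger than the displacement
    q(u) - p(u). But it can be replaced by an element with the same effect on
    p(u) whose size is O(|q(u) - p(u)|) ([orbit_displacement]); the first-order
    expansion of the action then shows that q(u) - p(u) is tangent to the orbit up
    to o(|u - u1|), which is what is needed ([displaced_derivative]).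

    The replacement is the shortest possible element. If its size were not
    controlled by the displacement, it would almost lie in the kernel of the
    differential of the orbit map, and multiplying it by an element of the
    stabilizer would shorten it. That the stabilizer has elements in all
    directions of this kernel ([stabilizer_approx]) is obtained from powers
    (v/n)^n and compactness. Uniformity in u comes from the constant rank of
    these differentials ([kernel_distance_le]). All these
    estimates rest on the strict differentiability of the group law and of the
    action ([chart_map2_strict]). *)

Set Implicit Arguments.
Unset Strict Implicit.
Unset Printing Implicit Defensive.

Import Order.TTheory GRing.Theory Num.Theory numFieldNormedType.Exports.

Local Open Scope classical_set_scope.
Local Open Scope ring_scope.

(** * Strict differentiability *)

Section MatrixNorm.
Context {R : realType}.

Lemma mx_entry_norm_le m n (A : 'M[R]_(m, n)) i j : `|A i j| <= `|A|.
Proof.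
by rewrite [leRHS]/Num.Def.normr /= mx_normrE; apply: (le_bigmax _ _ (i, j)).
Qed.

Lemma mx_norm_le m n (A : 'M[R]_(m, n)) b : 0 <= b ->
  (forall i j, `|A i j| <= b) -> `|A| <= b.
Proof.
move=> b0 Ab; rewrite [leLHS]/Num.Def.normr /= mx_normrE.
by apply: bigmax_le => // -[i j] _; exact: Ab.
Qed.

Lemma mulmx_norm_le m n p (A : 'M[R]_(m, n)) (B : 'M[R]_(n, p)) :
  `|A *m B| <= n%:R * (`|A| * `|B|).
Proof.
apply: mx_norm_le => [|i j]; first by rewrite !mulr_ge0.
rewrite mxE (le_trans (ler_norm_sum _ _ _))//.
rewrite mulr_natl -[X in _ *+ X]card_ord -sumr_const ler_sum// => k _.
by rewrite normrM ler_pM// mx_entry_norm_le.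
Qed.

Lemma norm_row_mx_le m n (x : 'rV[R]_m) (y : 'rV[R]_n) b :
  `|x| <= b -> `|y| <= b -> `|row_mx x y| <= b.
Proof.
move=> xb yb; apply: mx_norm_le => [|i j]; first exact: le_trans xb.
by rewrite mxE; case: splitP => k _; rewrite (le_trans (mx_entry_norm_le _ _ _)).
Qed.

(** The mean value theorem is applied to each coordinate of f along the segment
    from x to y. Continuity of the partial derivatives makes the error uniform
    in both end points, which differentiability at x0 does not give. *)
Lemma strict_differentiability m n (f : 'rV[R]_m -> 'rV[R]_n) (A : set 'rV[R]_m) x0 e :
  open A -> Ck 1 A f -> A x0 -> 0 < e ->
  exists2 d, 0 < d & forall x y, `|x - x0| < d -> `|y - x0| < d ->
    [/\ A x, A y & `|f y - f x - (y - x) *m 'J f x0| <= e * `|y - x|].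
Proof.
move=> oA [df Df] Ax0 e0.
have e1 : 0 < e / m.+1%:R by rewrite divr_gt0.
have nD : \forall x \near x0, forall i : 'I_m,
    `|'D_(delta_mx 0 i) f x0 - 'D_(delta_mx 0 i) f x| < e / m.+1%:R.
  apply: (@filter_forall _ _ (fun i x =>
    `|'D_(delta_mx 0 i) f x0 - 'D_(delta_mx 0 i) f x| < e / m.+1%:R) _
    (nbhs_filter x0)) => i.
  by have /cvgrPdist_lt := Df (delta_mx 0 i) _ Ax0; apply.
have /nbhs_ballP[d /= d0 Hd] :=
  @filterI _ _ (nbhs_filter x0) _ _ (open_nbhs_nbhs (conj oA Ax0)) nD.
exists d => // x y xd yd.
have ballP z : `|z - x0| < d -> ball x0 d z by rewrite -ball_normE/= distrC.
have [Ax _] := Hd x (ballP _ xd); have [Ay _] := Hd y (ballP _ yd); split=> //.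
pose z (s : R) := x + s *: (y - x).
have zd s : s \in `[0, 1] -> `|z s - x0| < d.
  rewrite in_itv/= => /andP[s0 s1].
  rewrite (_ : z s - x0 = (1 - s) *: (x - x0) + s *: (y - x0)); last first.
    by rewrite /z; apply/rowP => i; rewrite !mxE; ring.
  rewrite (le_lt_trans (ler_normD _ _))// !normrZ !ger0_norm ?subr_ge0//.
  have [->|sn0] := eqVneq s 0; first by rewrite mul0r addr0 subr0 mul1r.
  rewrite [ltRHS](_ : _ = (1 - s) * d + s * d); last by ring.
  apply: ler_ltD; first by apply: ler_wpM2l; rewrite ?subr_ge0// ltW.
  by rewrite ltr_pM2l// lt_def sn0.
apply: mx_norm_le => [|i j]; first by rewrite mulr_ge0// ltW.
rewrite (ord1 i) {i}.
pose phi (s : R) := f (z s) 0 j.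
have fz s : s \in `[0, 1] -> A (z s) by move=> /zd/ballP/Hd[].
have dphi (s : R) : s \in `[0, 1] ->
    is_derive s 1 phi (('D_(y - x) f (z s)) 0 j).
  move=> s01; have dfz := df _ (fz _ s01).
  have dz : differentiable z s.
    apply: differentiableD; first exact: differentiable_cst.
    exact: differentiableZl.
  have lc : linear (fun N : 'rV[R]_n => N 0 j : R).
    by move=> a u v; rewrite !mxE.
  pose cM := GRing.isLinear.Build _ _ _ _ _ lc.
  pose c : {linear 'rV[R]_n -> R} := HB.pack (fun N : 'rV[R]_n => N 0 j) cM.
  have cc : continuous c by exact: coord_continuous.
  have dc : differentiable c (f (z s)) by exact: linear_differentiable.
  have -> : phi = c \o (f \o z) by [].
  have dfz' : differentiable (f \o z) s by exact: differentiable_comp.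
  have dcfz : differentiable (c \o (f \o z)) s by exact: differentiable_comp.
  apply: DeriveDef; first exact/derivable1_diffP.
  have dzE : 'D_1 z s = y - x.
    rewrite /z deriveD//; last exact/derivable1_diffP.
    rewrite derive_cst add0r deriveE// diff_val.
    by rewrite scale1r.
  rewrite deriveE// (diff_comp dfz' dc)/= (diff_comp dz dfz)/=.
  rewrite -(deriveE _ dz) dzE -(deriveE _ dfz).
  by rewrite (diff_lin _ cc).
pose phi' (s : R) : R := 'D_(y - x) f (z s) 0 j.
have phi01 : forall s : R, s \in `]0, 1[%R -> is_derive s 1 phi (phi' s).
  move=> s; rewrite in_itv/= => /andP[s0 s1]; apply: dphi.
  by rewrite in_itv/= !ltW.
have cphi : {within `[0, 1], continuous phi}.
  apply/continuous_in_subspaceT => s s01.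
  rewrite inE in s01; apply/differentiable_continuous/derivable1_diffP.
  by have [] := dphi s s01.
have [s s01] := MVT_segment ler01 phi01 cphi.
rewrite /phi /phi' /z scale0r addr0 scale1r [x + (y - x)]addrC subrK => phiE.
have DJ u : A u -> forall i, 'J f u i j = 'D_(delta_mx 0 i) f u 0 j.
  by move=> Au i; rewrite (deriveEjacobian _ (df _ Au)) -rowE [RHS]mxE.
have {}phiE : f y 0 j - f x 0 j = ((y - x) *m 'J f (z s)) 0 j.
  by rewrite phiE subr0 mulr1 deriveEjacobian//; exact/df/fz.
have := DJ _ (fz _ s01); have := DJ _ Ax0.
move: ('J f x0) ('J f (z s)) phiE => J0 J1 phiE J0E J1E.
rewrite !mxE phiE !mxE.
rewrite -sumrB.
rewrite (le_trans (ler_norm_sum _ _ _))//.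
apply: (@le_trans _ _ (\sum_(i < m) `|y - x| * (e / m.+1%:R))); last first.
  rewrite sumr_const card_ord -mulrnAr [leRHS]mulrC.
  apply: ler_wpM2l => //; rewrite -mulr_natl mulrA ler_pdivrMr// mulrC.
  by apply: ler_wpM2l; rewrite ?(ltW e0)// ler_nat.
apply: ler_sum => i _; rewrite -mulrBr normrM; apply: ler_pM => //.
  by have := mx_entry_norm_le (y - x) 0 i; rewrite !mxE.
have [_ /(_ i)] := Hd _ (ballP _ (zd _ s01)).
rewrite distrC => /ltW; apply: le_trans.
have := mx_entry_norm_le ('D_(delta_mx 0 i) f (z s) - 'D_(delta_mx 0 i) f x0) 0 j.
by rewrite mxE [X in _ + X]mxE J0E J1E.
Qed.

End MatrixNorm.

(** * Jacobians, and the distance to a kernel of constant rank *)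

Section Linear.
Context {R : realType}.

Lemma near0_scale_lt n (r : 'rV[R]_n) d : 0 < d ->
  \forall t \near (0 : R), `|t *: r| < d.
Proof.
move=> d0; have r1 : 0 < `|r| + 1 by rewrite ltr_wpDl.
apply/nbhs_ballP; exists (d / (`|r| + 1)); first by rewrite /= divr_gt0.
move=> t /=; rewrite -ball_normE/= sub0r normrN normrZ => td.
apply: (@le_lt_trans _ _ (`|t| * (`|r| + 1))).
  by rewrite ler_wpM2l// lerDl.
by rewrite -ltr_pdivlMr.
Qed.

Lemma derive_affine_line m n (f : 'rV[R]_m -> 'rV[R]_n) x v u :
  (\forall t \near (0 : R), f (x + t *: v) = f x + t *: u) -> 'D_v f x = u.
Proof.
move=> fxv; apply: cvg_lim => //; apply: cvg_near_cst.
have /nbhs_ballP[e /= e0 He] := fxv.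
apply/nbhs_ballP; exists e => //= t te t0; have := He t te.
rewrite /= [t *: v + x]addrC => ->; rewrite [f x + _]addrC addrK scalerA.
by rewrite mulVf// scale1r.
Qed.

(** How the blocks of a Jacobian are read off below: along these lines the
    group laws make the maps affine. *)
Lemma mulmx_jacobian_affine m n (f : 'rV[R]_m -> 'rV[R]_n) x v u :
  differentiable f x ->
  (\forall t \near (0 : R), f (x + t *: v) = f x + t *: u) -> v *m 'J f x = u.
Proof. by move=> df /derive_affine_line <-; rewrite deriveEjacobian. Qed.

Lemma jacobian_entry m n (f : 'rV[R]_m -> 'rV[R]_n) x i j :
  differentiable f x -> 'J f x i j = 'D_(delta_mx 0 i) f x 0 j.
Proof. by move=> df; rewrite (deriveEjacobian _ df) -rowE [RHS]mxE. Qed.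

Lemma mx_subE m n (A B : 'M[R]_(m, n)) i j : (A - B) i j = A i j - B i j.
Proof. by rewrite !mxE. Qed.

Lemma jacobian_continuous m n (f : 'rV[R]_m -> 'rV[R]_n) (A : set 'rV[R]_m) x0 e :
  open A -> Ck 1 A f -> A x0 -> 0 < e ->
  exists2 d, 0 < d & forall x, `|x - x0| < d -> `|'J f x - 'J f x0| <= e.
Proof.
move=> oA [df Df] Ax0 e0.
have nD : \forall x \near x0, forall i : 'I_m,
    `|'D_(delta_mx 0 i) f x0 - 'D_(delta_mx 0 i) f x| < e.
  apply: (@filter_forall _ _ (fun i x =>
    `|'D_(delta_mx 0 i) f x0 - 'D_(delta_mx 0 i) f x| < e) _
    (nbhs_filter x0)) => i.
  by have /cvgrPdist_lt := Df (delta_mx 0 i) _ Ax0; apply.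
have /nbhs_ballP[d /= d0 Hd] :=
  @filterI _ _ (nbhs_filter x0) _ _ (open_nbhs_nbhs (conj oA Ax0)) nD.
exists d => // x xd; have [|Ax Dx] := Hd x; first by rewrite -ball_normE/= distrC.
apply: mx_norm_le => [|i j]; first exact: ltW.
rewrite mx_subE.
have E : 'J f x i j - 'J f x0 i j =
    ('D_(delta_mx 0 i) f x - 'D_(delta_mx 0 i) f x0) 0 j.
  by rewrite mx_subE; congr (_ - _); apply: jacobian_entry; exact: df.
rewrite [X in `|X|]E (le_trans (mx_entry_norm_le _ _ _))//.
by rewrite distrC ltW.
Qed.

(** Take P and Q with P L0 Q = 1, of size the rank of L0. For L near L0 the
    product P L Q stays invertible, with a bounded inverse, and since the rank
    of L does not exceed that of L0 the rows of P L span those of L. So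
    x L = z P L with z controlled by x L, and y = x - z P. If the rank could
    jump, L might have a nonzero but arbitrarily small slope on the kernel of
    L0, and no constant C would do. *)
Lemma kernel_distance_le m n (L0 : 'M[R]_(m, n)) :
  exists C d, [/\ 0 < C, 0 < d & forall L : 'M[R]_(m, n),
    `|L - L0| < d -> (\rank L <= \rank L0)%N ->
    forall x : 'rV[R]_m, exists2 y : 'rV[R]_m, y *m L = 0 &
      `|x - y| <= C * `|x *m L|].
Proof.
set r := \rank L0.
pose P : 'M[R]_(r, m) := pinvmx (col_base L0).
pose Q : 'M[R]_(n, r) := pinvmx (row_base L0).
have PLQ : P *m L0 *m Q = 1%:M.
  rewrite -[L0 in P *m L0]mulmx_base -mulmxA -[_ *m _ *m Q]mulmxA mulmxA.
  rewrite /P mulVpmx ?col_base_full// mul1mx.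
  by rewrite /Q mulmxVp// row_base_free.
(* |P (L - L0) Q| <= K |L - L0|; the radius below makes r K |L - L0| <= 1/2. *)
pose K := m%:R * (`|P| * (n%:R * `|Q|)).
have K0 : 0 <= K by rewrite !mulr_ge0.
exists (r%:R * (2 * (n%:R * `|Q|)) * `|P| + 1), (2 * (r%:R * K + 1))^-1; split.
- by rewrite ltr_wpDl// !mulr_ge0.
- by rewrite invr_gt0 mulr_gt0// ltr_wpDl// mulr_ge0.
move=> L LL0 rL x.
pose N := P *m L *m Q.
have N1 : r%:R * `|1%:M - N| <= 2^-1.
  rewrite -PLQ /N -mulmxBl -mulmxBr.
  have le1 : `|P *m (L0 - L) *m Q| <= K * `|L - L0|.
    rewrite -mulmxA (le_trans (mulmx_norm_le _ _))// /K -!mulrA ler_wpM2l//.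
    rewrite ler_wpM2l// (le_trans (mulmx_norm_le _ _))// ler_wpM2l//.
    by rewrite mulrC distrC.
  have le2 : r%:R * `|P *m (L0 - L) *m Q| <= r%:R * K * `|L - L0|.
    by rewrite -mulrA ler_wpM2l.
  apply: (le_trans le2).
  have : (r%:R * K + 1) * `|L - L0| <= 2^-1.
    rewrite mulrC -ler_pdivlMr ?ltr_wpDl ?mulr_ge0// -invfM ltW//.
  by apply: le_trans; rewrite ler_wpM2r// lerDl.
(* In place of a bound on the inverse of N = P L Q. *)
have Nlow (z : 'rV[R]_r) : `|z| <= 2 * `|z *m N|.
  have : `|z| <= `|z *m (1%:M - N)| + `|z *m N|.
    by rewrite mulmxBr mulmx1 -{1}[z](subrK (z *m N)) ler_normD.
  have : `|z *m (1%:M - N)| <= 2^-1 * `|z|.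
    rewrite (le_trans (mulmx_norm_le _ _))// mulrCA mulrC ler_wpM2r//.
  move=> h1 h2; lra.
have fN : row_free N.
  rewrite -kermx_eq0; apply/eqP/row_matrixP => i.
  apply/eqP; rewrite row0 -normr_le0 (le_trans (Nlow _))//.
  by rewrite -row_mul mulmx_ker row0 normr0 mulr0.
have rPL : \rank (P *m L) = r.
  apply/eqP; rewrite eqn_leq rank_leq_row/= -[X in (X <= _)%N](eqP fN).
  exact: mxrankM_maxl.
have PLL : (L <= P *m L)%MS.
  have := mxrank_leqif_sup (submxMl P L) => -[_ <-].
  by rewrite rPL eqn_leq rL andbT -[X in (X <= _)%N]rPL mxrankM_maxr.
have /submxP[z zE] : (x *m L <= P *m L)%MS by apply: submx_trans PLL; exact: submxMl.
exists (x - z *m P); first by rewrite mulmxBl zE mulmxA subrr.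
rewrite opprB addrC subrK.
have zle : `|z| <= 2 * (n%:R * `|Q|) * `|x *m L|.
  rewrite (le_trans (Nlow _))// /N mulmxA -zE -mulrA ler_wpM2l//.
  by rewrite (le_trans (mulmx_norm_le _ _))// -mulrA ler_wpM2l// mulrC.
rewrite (le_trans (mulmx_norm_le _ _))// mulrDl mul1r.
apply: ler_wpDr => //; rewrite -!mulrA ler_wpM2l//.
apply: (le_trans (ler_wpM2r (normr_ge0 P) zle)).
by rewrite -!mulrA [`|P| * _]mulrC.
Qed.

End Linear.

(** * The group law and the action in charts *)

Section Charts.
Context {R : realType}.

Lemma chart_inv_continuous (M : topologicalType) d (c : chart (R := R) M d) y :
  cimg c y -> {for y, continuous (cinv c)}.
Proof.
move=> cy; have := @cinv_continuous _ _ _ c.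
by rewrite (continuous_open_subspace _ (@cimg_open _ _ _ c)); apply; rewrite inE.
Qed.

Lemma chart_map_continuous (M : topologicalType) d (c : chart (R := R) M d) x :
  cdom c x -> {for x, continuous (cmap c)}.
Proof.
move=> cx; have := @cmap_continuous _ _ _ c.
by rewrite (continuous_open_subspace _ (@cdom_open _ _ _ c)); apply; rewrite inE.
Qed.

Lemma chart_map_inj (M : topologicalType) d (c : chart (R := R) M d) x x' :
  cdom c x -> cdom c x' -> cmap c x = cmap c x' -> x = x'.
Proof. by move=> cx cx' xx'; rewrite -(cmapK cx) xx' cmapK. Qed.

Context {N1 N2 P : topologicalType} {S1 : smooth_manifold R N1}
  {S2 : smooth_manifold R N2} {SP : smooth_manifold R P} (f : N1 -> N2 -> P).

(** The coordinate expression whose smoothness on the next set is the content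
    of [smooth_map2]. *)
Definition chart_map2 n1 n2 n (b1 : chart (R := R) N1 n1)
    (b2 : chart (R := R) N2 n2) (c : chart (R := R) P n)
    (z : 'rV[R]_(n1 + n2)) : 'rV[R]_n :=
  cmap c (f (cinv b1 (lsubmx z)) (cinv b2 (rsubmx z))).

Definition chart_map2_dom n1 n2 n (b1 : chart (R := R) N1 n1)
    (b2 : chart (R := R) N2 n2) (c : chart (R := R) P n) :
    set 'rV[R]_(n1 + n2) :=
  [set z | [/\ cimg b1 (lsubmx z), cimg b2 (rsubmx z) &
             cdom c (f (cinv b1 (lsubmx z)) (cinv b2 (rsubmx z)))]].

Lemma chart_map2_dom_open n1 n2 n (b1 : chart (R := R) N1 n1)
    (b2 : chart (R := R) N2 n2) (c : chart (R := R) P n) :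
  continuous (fun z : N1 * N2 => f z.1 z.2) -> open (chart_map2_dom b1 b2 c).
Proof.
move=> cf.
have oE : open ((@lsubmx R 1 n1 n2 @^-1` cimg b1) `&` (@rsubmx R 1 n1 n2 @^-1` cimg b2)).
  apply: openI; apply: open_comp => [z _|]; last exact: cimg_open.
  - exact: continuous_lsubmx.
  - exact: cimg_open.
  - exact: continuous_rsubmx.
rewrite (_ : chart_map2_dom _ _ _ = ((@lsubmx R 1 n1 n2 @^-1` cimg b1) `&`
    (@rsubmx R 1 n1 n2 @^-1` cimg b2)) `&`
    ((fun z => f (cinv b1 (lsubmx z)) (cinv b2 (rsubmx z))) @^-1` cdom c)); last first.
  by apply/seteqP; split=> [z []//|z [[]]].
apply: open_preimage_at => //; last exact: cdom_open.
move=> z [z1 z2].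
apply: (@continuous_comp _ _ _
    (fun z => (cinv b1 (lsubmx z), cinv b2 (rsubmx z)))
    (fun z : N1 * N2 => f z.1 z.2)); last exact: cf.
have cl : {for z, continuous (fun z => cinv b1 (@lsubmx R 1 n1 n2 z))}.
  apply: (@continuous_comp _ _ _ (@lsubmx R 1 n1 n2) (cinv b1)).
    exact: continuous_lsubmx.
  exact: chart_inv_continuous.
have cr : {for z, continuous (fun z => cinv b2 (@rsubmx R 1 n1 n2 z))}.
  apply: (@continuous_comp _ _ _ (@rsubmx R 1 n1 n2) (cinv b2)).
    exact: continuous_rsubmx.
  exact: chart_inv_continuous.
exact: (cvg_pair cl cr).
Qed.

Lemma chart_map2_strict b1 b2 c y1 y2 e :
  smooth_map2 S1 S2 SP f -> atlas S1 b1 -> atlas S2 b2 -> atlas SP c ->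
  cimg b1 y1 -> cimg b2 y2 -> cdom c (f (cinv b1 y1) (cinv b2 y2)) -> 0 < e ->
  exists2 d, 0 < d & forall x1 x2 z1 z2,
    `|x1 - y1| < d -> `|x2 - y2| < d -> `|z1 - y1| < d -> `|z2 - y2| < d ->
    [/\ cimg b1 x1, cimg b2 x2, cdom c (f (cinv b1 x1) (cinv b2 x2)) &
      `|chart_map2 b1 b2 c (row_mx z1 z2) - chart_map2 b1 b2 c (row_mx x1 x2) -
        row_mx (z1 - x1) (z2 - x2) *m 'J (chart_map2 b1 b2 c) (row_mx y1 y2)| <=
      e * `|row_mx (z1 - x1) (z2 - x2)|].
Proof.
move=> [cf sf] ab1 ab2 ac by1 by2 fc e0.
have oE := chart_map2_dom_open (b1 := b1) (b2 := b2) (c := c) cf.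
have Ey : chart_map2_dom b1 b2 c (row_mx y1 y2).
  by split; rewrite ?row_mxKl ?row_mxKr.
have [d d0 Hd] := strict_differentiability oE (sf _ _ _ ab1 ab2 ac 1%N) Ey e0.
exists d => // x1 x2 z1 z2 xd1 xd2 zd1 zd2.
have lt_row u v : `|u - y1| < d -> `|v - y2| < d ->
    `|row_mx u v - row_mx y1 y2| < d.
  move=> ud vd; rewrite opp_row_mx add_row_mx.
  have [uv|vu] := leP `|u - y1| `|v - y2|.
    by apply: le_lt_trans vd; exact: norm_row_mx_le.
  by apply: le_lt_trans ud; apply: norm_row_mx_le => //; exact: ltW.
have [[]] := Hd _ _ (lt_row _ _ xd1 xd2) (lt_row _ _ zd1 zd2).
rewrite !row_mxKl !row_mxKr => cx1 cx2 cfx _.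
by rewrite opp_row_mx add_row_mx /chart_map2 !row_mxKl !row_mxKr.
Qed.

End Charts.

Section LocalAction.
Context {R : realType} {G : groupTopologicalType} {LG : lie_group R G}.
Context {M : topologicalType} {SM : smooth_manifold R M} (a : smooth_action LG SM).
Variables (b : chart (R := R) G (mdim LG)) (c : chart (R := R) M (mdim SM)).
Hypotheses (ab : atlas LG b) (ac : atlas SM c) (b1 : cdom b 1%g).

(** Coordinates of G centred at the unit; they are used like a logarithm. *)
Definition log_coord (g : G) : 'rV[R]_(mdim LG) := cmap b g - cmap b 1%g.
Local Notation nu := log_coord.

(** The differential at 1 of the orbit map g |-> g x, x being the point of
    coordinates y: the rows of the Jacobian of the action in the directions of
    G. Vectors are rows, so it acts on them on the right. *)
Definition orbit_differential (y : 'rV[R]_(mdim SM)) : 'M[R]_(mdim LG, mdim SM) :=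
  usubmx ('J (chart_map2 a b c c) (row_mx (cmap b 1%g) y)).
Local Notation L := orbit_differential.

Definition chart_act (g : G) (y : 'rV[R]_(mdim SM)) : 'rV[R]_(mdim SM) :=
  cmap c (a g (cinv c y)).

Lemma row_mx0_mul m n p (x : 'rV[R]_m) (A : 'M[R]_(m + n, p)) :
  row_mx x 0 *m A = x *m usubmx A.
Proof. by rewrite -[A in LHS]vsubmxK mul_row_col mul0mx addr0. Qed.

Lemma chart_map2_act g y : cdom b g ->
  chart_map2 a b c c (row_mx (cmap b g) y) = chart_act g y.
Proof. by move=> bg; rewrite /chart_map2 row_mxKl row_mxKr cmapK. Qed.

Lemma chart_act1 y : cimg c y -> chart_act 1%g y = y.
Proof. by move=> cy; rewrite /chart_act act_one cinvK. Qed.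

Lemma log_coord1 : nu 1%g = 0. Proof. by rewrite /nu subrr. Qed.

(** To first order the multiplication of G is the addition of coordinates. The
    error is measured by g alone, because both sides agree when g = 1; hence
    the errors made in a product of n elements of size |v| / n add up to e |v|. *)
Lemma log_coord_mul e : 0 < e -> exists2 d, 0 < d & forall g h,
  cdom b g -> cdom b h -> `|nu g| < d -> `|nu h| < d ->
  cdom b (g * h)%g /\ `|nu (g * h)%g - nu g - nu h| <= e * `|nu g|.
Proof.
move=> e0.
have bi1 : cimg b (cmap b 1%g) by exact: cmap_img.
have b11 : cdom b (cinv b (cmap b 1%g) * cinv b (cmap b 1%g))%g.
  by rewrite cmapK// mulg1.
set mul := fun g h : G => (g * h)%g.
have [d d0 Hd] := chart_map2_strict (lie_mul_smooth LG) ab ab ab bi1 bi1 b11 e0.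
set F := chart_map2 mul b b b.
set J := 'J F _ in Hd.
have JE (u : 'rV[R]_(mdim LG)) : u *m usubmx J = u.
  rewrite -row_mx0_mul; apply: mulmx_jacobian_affine.
    have [cf sf] := lie_mul_smooth LG.
    have [df _] := sf _ _ _ ab ab ab 1%N.
    by apply: df; split; rewrite ?row_mxKl ?row_mxKr.
  apply: filterS (near0_scale_lt u d0) => t td.
  rewrite scale_row_mx scaler0 add_row_mx addr0.
  have tu : `|cmap b 1%g + t *: u - cmap b 1%g| < d by rewrite addrC addKr.
  have dd : `|cmap b 1%g - cmap b 1%g| < d by rewrite subrr normr0.
  have [bt _ _ _] := Hd _ _ _ _ tu dd dd dd.
  by rewrite /F /chart_map2 !row_mxKl !row_mxKr cmapK// /mul !mulg1 cinvK.
exists d => // g h bg bh gd hd.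
have dd : `|cmap b 1%g - cmap b 1%g| < d by rewrite subrr normr0.
have [_ _ bgh _] := Hd _ _ _ _ gd hd dd dd.
rewrite !cmapK// in bgh; split=> //.
have [_ _ _] := Hd _ _ _ _ dd hd gd hd.
rewrite subrr row_mx0_mul JE /F /chart_map2 !row_mxKl !row_mxKr !cmapK// /mul mul1g.
move=> le_e.
rewrite (_ : nu _ - _ - _ =
    cmap b (g * h)%g - cmap b h - (cmap b g - cmap b 1%g)).
  by apply: (le_trans le_e); rewrite ler_wpM2l ?(ltW e0)// norm_row_mx_le// normr0.
by rewrite /nu; apply/rowP => i; rewrite !mxE; ring.
Qed.

(** Strict differentiability of the action at (1, y0), in the directions of G
    for the third conclusion and in those of M for the last one: the elements
    of G near 1 are Lipschitz near y0 with a common constant. *)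
Lemma chart_act_strict y0 e : cimg c y0 -> 0 < e ->
  exists2 d, 0 < d & forall g y y', cdom b g -> `|nu g| < d ->
    `|y - y0| < d -> `|y' - y0| < d ->
    [/\ cimg c y, cdom c (a g (cinv c y)),
      `|chart_act g y - y - nu g *m L y0| <= e * `|nu g| &
      `|chart_act g y' - chart_act g y| <=
        (e + (mdim LG + mdim SM)%:R *
          `|'J (chart_map2 a b c c) (row_mx (cmap b 1%g) y0)|) * `|y' - y|].
Proof.
move=> cy0 e0.
have bi1 : cimg b (cmap b 1%g) by exact: cmap_img.
have ca1 : cdom c (a (cinv b (cmap b 1%g)) (cinv c y0)).
  by rewrite cmapK// act_one; exact: cinv_dom.
have [d d0 Hd] := chart_map2_strict (act_smooth a) ab ac ac bi1 cy0 ca1 e0.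
exists d => // g y y' bg gd yd yd'.
have dd : `|cmap b 1%g - cmap b 1%g| < d by rewrite subrr normr0.
have [_ cy cgy _] := Hd _ _ _ _ gd yd gd yd.
rewrite cmapK// in cgy; split=> //.
  have [_ _ _] := Hd _ _ _ _ dd yd gd yd.
  rewrite subrr row_mx0_mul !chart_map2_act// chart_act1// => /le_trans; apply.
  by rewrite ler_wpM2l ?(ltW e0)// norm_row_mx_le// normr0.
have [_ _ _] := Hd _ _ _ _ gd yd gd yd'.
rewrite subrr !chart_map2_act// => le_e.
have le_r : `|row_mx (0 : 'rV[R]_(mdim LG)) (y' - y)| <= `|y' - y|.
  by rewrite norm_row_mx_le// normr0.
rewrite mulrDl; set J := 'J _ _ in le_e *.
rewrite -[chart_act g y' - _](subrK (row_mx 0 (y' - y) *m J)).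
rewrite (le_trans (ler_normD _ _))// lerD//.
  by apply: (le_trans le_e); rewrite ler_wpM2l ?(ltW e0).
rewrite (le_trans (mulmx_norm_le _ _))// -mulrA ler_wpM2l// mulrC ler_wpM2l//.
Qed.

Lemma orbit_differential_continuous y0 e : cimg c y0 -> 0 < e ->
  exists2 d, 0 < d & forall y, `|y - y0| < d -> `|L y - L y0| <= e.
Proof.
move=> cy0 e0.
have [cf sf] := act_smooth a.
have oE := chart_map2_dom_open (b1 := b) (b2 := c) (c := c) cf.
have Ey : chart_map2_dom a b c c (row_mx (cmap b 1%g) y0).
  split; rewrite ?row_mxKl ?row_mxKr//; first exact: cmap_img.
  by rewrite cmapK// act_one; exact: cinv_dom.
have [d d0 Hd] := jacobian_continuous oE (sf _ _ _ ab ac ac 1%N) Ey e0.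
exists d => // y yd; apply: mx_norm_le => [|i j]; first exact: ltW.
have : `|row_mx (cmap b 1%g) y - row_mx (cmap b 1%g) y0| < d.
  rewrite opp_row_mx add_row_mx subrr.
  by apply: le_lt_trans yd; rewrite norm_row_mx_le// normr0.
move=> /Hd; rewrite /L /chart_map2.
move: ('J _ _) ('J _ _) => J J0; apply: le_trans.
rewrite -linearB mxE; exact: mx_entry_norm_le.
Qed.

End LocalAction.

(** * Elements of a stabilizer with prescribed direction *)

Section Balls.
Context {R : realType}.

Lemma compact_norm_ball n (x : 'rV[R]_n) r : compact [set y | `|y - x| <= r].
Proof.
apply: bounded_closed_compact.
  exists (`|x| + r); split; first exact: num_real.
  move=> M rM y /= yr; rewrite -[y](subrK x) (le_trans (ler_normD _ _))// addrC.
  by rewrite (le_trans _ (ltW rM))// lerD2l.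
have cn : continuous (fun y : 'rV[R]_n => `|y - x|).
  by move=> y; apply: (cvg_norm (cvgB cvg_id (cvg_cst _))).
have := @closed_comp _ _ (fun y : 'rV[R]_n => `|y - x|) [set t | t <= r].
by apply=> [y _|]; [exact: cn|exact: closed_le].
Qed.

Lemma open_norm_ball n (A : set 'rV[R]_n) x : open A -> A x ->
  exists2 d, 0 < d & forall y, `|y - x| < d -> A y.
Proof.
move=> oA Ax; have /nbhs_ballP[d /= d0 Hd] := open_nbhs_nbhs (conj oA Ax).
by exists d => // y yd; apply: Hd; rewrite -ball_normE/= distrC.
Qed.

End Balls.

Section Stabilizer.
Context {R : realType} {G : groupTopologicalType} {LG : lie_group R G}.
Context {M : topologicalType} {SM : smooth_manifold R M} (a : smooth_action LG SM).
Variables (b : chart (R := R) G (mdim LG)) (c : chart (R := R) M (mdim SM)).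
Hypotheses (ab : atlas LG b) (ac : atlas SM c) (b1 : cdom b 1%g).
Local Notation nu := (log_coord b).
Local Notation L := (orbit_differential a b c).
Local Notation e0 := (cmap b 1%g).

Lemma log_coord_cinv v : cimg b (e0 + v) -> nu (cinv b (e0 + v)) = v.
Proof. by move=> bv; rewrite /log_coord cinvK// addrC addKr. Qed.

Lemma orbit_coord_continuous x y : cimg b x -> cimg c y ->
  cdom c (a (cinv b x) (cinv c y)) ->
  {for x, continuous (fun x => chart_act a c (cinv b x) y)}.
Proof.
move=> bx cy cxy.
have ca := (act_smooth a).1.
have c1 : {for x, continuous (fun x => a (cinv b x) (cinv c y))}.
  apply: (@continuous_comp _ _ _ (fun x => (cinv b x, cinv c y))
    (fun z : G * M => a z.1 z.2)); last exact: ca.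
  have cl := chart_inv_continuous bx.
  have cr : {for x, continuous (fun _ : 'rV[R]_(mdim LG) => cinv c y)}.
    exact: cst_continuous.
  exact: (cvg_pair cl cr).
apply: (@continuous_comp _ _ _ (fun x => a (cinv b x) (cinv c y)) (cmap c)) => //.
exact: chart_map_continuous.
Qed.

(** The Lie algebra of a stabilizer is the kernel of the differential of the
    orbit map; this is the half of that fact which is needed, without the
    exponential map. Let gam be the element with coordinates v/n. By
    [log_coord_mul] the powers of gam up to the n-th stay within e |v| of the
    segment from 0 to v. As v is in the kernel, gam moves the point y by
    o(1/n), and by the common Lipschitz constant gam^(j+1) y is as close to
    gam^j y, so that the n-th power moves y by o(1). By compactness, some k
    within e |v| of v does not move y at all. *)
Lemma stabilizer_approx y0 e : cimg c y0 -> 0 < e ->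
  exists2 d, 0 < d & forall y v, `|y - y0| < d -> v *m L y = 0 -> `|v| < d ->
  exists k, [/\ cdom b k, a k (cinv c y) = cinv c y & `|nu k - v| <= e * `|v|].
Proof.
move=> cy0; wlog e_le1 : e / e <= 1.
  move=> H e_gt0; have m0 : 0 < Num.min e 1 by rewrite lt_min e_gt0/=.
  have [|d d0 Hd] := H (Num.min e 1) _ m0; first by rewrite ge_min lexx orbT.
  exists d => // y v yd vL vd; have [k [bk sk nk]] := Hd y v yd vL vd.
  exists k; split=> //; apply: (le_trans nk).
  by rewrite ler_wpM2r// ge_min lexx.
move=> e_gt0.
have [d1 d1_gt0 mulP] := log_coord_mul ab b1 e_gt0.
have [d2 d2_gt0 actP] := chart_act_strict a ab ac b1 cy0 ltr01.
pose K := 1 + (mdim LG + mdim SM)%:R * `|'J (chart_map2 a b c c) (row_mx e0 y0)|.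
rewrite -/K in actP.
have K0 : 0 <= K by rewrite /K addr_ge0// mulr_ge0.
have [d3 d3_gt0 imgP] := open_norm_ball (@cimg_open _ _ _ b) (cmap_img b1).
pose d := Num.min (d1 / 2) (Num.min (d2 / 2) (d3 / 2)).
have d_gt0 : 0 < d by rewrite !lt_min !divr_gt0.
have [dd1 dd2 dd3] : [/\ 2 * d <= d1, 2 * d <= d2 & 2 * d <= d3].
  by split; rewrite mulrC -ler_pdivlMr// !ge_min lexx ?orbT.
exists d => // y v yd vL vd.
have yd2 : `|y - y0| < d2 by lra.
have nu1 : `|nu 1%g| < d2 by rewrite log_coord1 normr0.
have [cy _ _ _] := actP 1%g y y b1 nu1 yd2 yd2.
have v2 w : `|w - v| <= e * `|v| -> `|w| < 2 * d.
  move=> wv; have : `|w| <= `|w - v| + `|v| by rewrite -{1}[w](subrK v) ler_normD.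
  have : e * `|v| <= `|v| by rewrite ler_piMl.
  lra.
pose gam n : G := cinv b (e0 + n%:R^-1 *: v).
have gamP n : (0 < n)%N -> cdom b (gam n) /\ nu (gam n) = n%:R^-1 *: v.
  move=> n0; have bi : cimg b (e0 + n%:R^-1 *: v).
    apply: imgP; rewrite addrC addKr normrZ ger0_norm ?invr_ge0//.
    have : n%:R^-1 * `|v| <= `|v| by rewrite ler_piMl// invf_le1 ?ler1n ?ltr0n.
    lra.
  by split; [exact: cinv_dom|exact: log_coord_cinv].
have small n j w : (0 < n)%N -> (j <= n)%N ->
    `|w - (j%:R / n%:R) *: v| <= e * (j%:R / n%:R * `|v|) -> `|w| < 2 * d.
  move=> n0 jn wv.
  have jn1 : j%:R / n%:R <= 1 :> R by rewrite ler_pdivrMr ?ltr0n// mul1r ler_nat.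
  have jn0 : 0 <= j%:R / n%:R :> R by rewrite divr_ge0.
  have : `|w| <= `|w - (j%:R / n%:R) *: v| + j%:R / n%:R * `|v|.
    rewrite -[X in _ + X * _]ger0_norm// -normrZ.
    by rewrite -{1}[w](subrK ((j%:R / n%:R) *: v)) ler_normD.
  have t1 : j%:R / n%:R * `|v| <= `|v| by rewrite ler_piMl.
  have t2 : e * (j%:R / n%:R * `|v|) <= j%:R / n%:R * `|v|.
    by rewrite ler_piMl// mulr_ge0.
  lra.
have gamX n j : (0 < n)%N -> (j <= n)%N -> cdom b (gam n ^+ j)%g /\
    `|nu (gam n ^+ j)%g - (j%:R / n%:R) *: v| <= e * (j%:R / n%:R * `|v|).
  move=> n0; have [bg ng] := gamP n n0.
  have n0' : 0 < n%:R :> R by rewrite ltr0n.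
  elim: j => [_|j IH jn].
    by rewrite expg0 log_coord1 !mul0r scale0r subr0 normr0 mulr0.
  have [bj nj] := IH (ltnW jn).
  have ngd : `|nu (gam n)| < d1.
    rewrite ng normrZ ger0_norm ?invr_ge0//.
    have : n%:R^-1 * `|v| <= `|v| by rewrite ler_piMl// invf_le1 ?ler1n.
    lra.
  have njd : `|nu (gam n ^+ j)%g| < d1.
    by apply: lt_le_trans dd1; exact: small n0 (ltnW jn) nj.
  have [bS nS] := mulP _ _ bg bj ngd njd.
  rewrite expgS; split=> //.
  rewrite (_ : _ - _ = (nu (gam n * gam n ^+ j)%g - nu (gam n) - nu (gam n ^+ j)%g) +
     (nu (gam n ^+ j)%g - (j%:R / n%:R) *: v)); last first.
    rewrite ng -natr1; apply/rowP => i; rewrite !mxE; ring.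
  rewrite (le_trans (ler_normD _ _))//.
  apply: (le_trans (lerD nS nj)).
  rewrite ng normrZ ger0_norm ?invr_ge0// -natr1 mulrDl mul1r mulrDl mulrDr.
  by rewrite addrC.
pose f x := chart_act a c (cinv b x) y.
pose Q := [set x | `|x - (e0 + v)| <= e * `|v|].
have QP x : Q x -> [/\ cimg b x, cdom c (a (cinv b x) (cinv c y)) &
    `|nu (cinv b x)| < 2 * d].
  move=> Qx; have xE : x = e0 + (x - e0) by rewrite addrC subrK.
  have xd : `|x - e0| < 2 * d by apply: v2; rewrite -addrA -opprD.
  have bx : cimg b x by apply: imgP; lra.
  have nx : nu (cinv b x) = x - e0 by rewrite /log_coord cinvK.
  split=> //; last by rewrite nx.
  have nx2 : `|nu (cinv b x)| < d2 by rewrite nx; lra.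
  by have [] := actP (cinv b x) y y (cinv_dom bx) nx2 yd2 yd2.
have Qgam n : (0 < n)%N -> Q (cmap b (gam n ^+ n)%g).
  move=> n0; have [_] := gamX n n n0 (leqnn _).
  rewrite divff ?pnatr_eq0 -?lt0n// scale1r mul1r => le_e.
  by rewrite /Q/= opprD addrA.
have cF : {within Q, continuous (fun x => `|f x - y|)}.
  apply/continuous_in_subspaceT => x; rewrite inE => Qx.
  have [bx cx _] := QP x Qx.
  apply: (@continuous_comp _ _ _ (fun x => f x - y) (fun z => `|z|)).
    have cy' : {for x, continuous (fun _ : 'rV[R]_(mdim LG) => y)}.
      exact: cst_continuous.
    exact: (continuousB (orbit_coord_continuous bx cy cx) cy').
  exact: norm_continuous.
have Q0 : Q !=set0 by exists (cmap b (gam 1%N ^+ 1%N)%g); exact: Qgam.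
have [x] := compact_EVT_min Q0 (@compact_norm_ball _ _ _ _) cF.
rewrite inE => Qx xmin.
have [bx cx nx] := QP x Qx.
(* The minimum over Q of the displacement of y is 0, because the powers gam^n
   are in Q and make it arbitrarily small. *)
have smallF t : 0 < t -> `|f x - y| <= K * (t * `|v|).
  move=> t0.
  have [d4 d4_gt0 actP4] := chart_act_strict a ab ac b1 cy t0.
  (* One term makes |v| / n < d4, the other one t |v| / n < d. *)
  pose n := (Num.truncn (`|v| / d4 + t * `|v| / d)).+1.
  have n0' : 0 < n%:R :> R by rewrite ltr0n.
  have nv : `|v| / d4 + t * `|v| / d < n%:R by exact: truncnS_gt.
  have vd0 : 0 <= t * `|v| / d by rewrite !mulr_ge0// ?invr_ge0 ltW.
  have vd4 : 0 <= `|v| / d4 by rewrite mulr_ge0// invr_ge0 ltW.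
  have nv1 : `|v| / n%:R < d4.
    by rewrite ltr_pdivrMr// mulrC -ltr_pdivrMr//; lra.
  have nv2 : t * (`|v| / n%:R) < d.
    by rewrite mulrA ltr_pdivrMr// [d * _]mulrC -ltr_pdivrMr//; lra.
  have [bg ng] := gamP n isT.
  have yy d' : 0 < d' -> `|y - y| < d' by rewrite subrr normr0.
  have ng4 : `|nu (gam n)| < d4 by rewrite ng normrZ ger0_norm ?invr_ge0// mulrC.
  have [_ cgy + _] := actP4 (gam n) y y bg ng4 (yy _ d4_gt0) (yy _ d4_gt0).
  rewrite ng -scalemxAl vL scaler0 subr0 => le_t.
  have {}le_t : `|chart_act a c (gam n) y - y| <= t * (`|v| / n%:R).
    by move: le_t; rewrite normrZ ger0_norm ?invr_ge0// [_^-1 * _]mulrC.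
  have step j : (j <= n)%N ->
     `|chart_act a c (gam n ^+ j)%g y - y| <= j%:R * (K * (t * (`|v| / n%:R))).
    elim: j => [_|j IH jn]; first by rewrite expg0 chart_act1// subrr normr0 mul0r.
    have [bj nj] := gamX n j isT (ltnW jn).
    have nj1 : `|nu (gam n ^+ j)%g| < d2.
      by apply: lt_le_trans dd2; exact: (@small n j _ isT (ltnW jn) nj).
    have y'd : `|chart_act a c (gam n) y - y0| < d2.
      have : `|chart_act a c (gam n) y - y0| <= `|chart_act a c (gam n) y - y| + `|y - y0|.
        exact: ler_distD.
      lra.
    have [_ _ _ Lip] := actP _ y _ bj nj1 yd2 y'd.
    have -> : chart_act a c (gam n ^+ j.+1)%g y =
        chart_act a c (gam n ^+ j)%g (chart_act a c (gam n) y).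
      by rewrite expgSr /chart_act act_mul (cmapK cgy).
    apply: (le_trans (ler_distD (chart_act a c (gam n ^+ j)%g y) _ _)).
    rewrite -natr1 mulrDl mul1r addrC.
    apply: lerD; first exact: IH (ltnW jn).
    by apply: (le_trans Lip); rewrite ler_wpM2l.
  have := xmin _ (mem_set (Qgam n isT)).
  have [bn _] := gamX n n isT (leqnn _).
  rewrite /f cmapK// => /le_trans; apply.
  apply: (le_trans (step n (leqnn _))).
  rewrite le_eqVlt; apply/orP; left; apply/eqP; field.
  by rewrite gt_eqF.
have fx : f x = y.
  apply/eqP; rewrite -subr_eq0 -normr_eq0 eq_le normr_ge0 andbT leNgt.
  apply/negP => fx_gt0.
  have Kv : 0 < K * `|v| + 1 by rewrite ltr_wpDl// mulr_ge0.
  have := smallF (`|f x - y| / (K * `|v| + 1)) (divr_gt0 fx_gt0 Kv).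
  rewrite (_ : K * _ = `|f x - y| * (K * `|v|) / (K * `|v| + 1)); last by ring.
  rewrite leNgt => /negP; apply.
  by rewrite ltr_pdivrMr// mulrDr mulr1 ltrDl.
exists (cinv b x); split; first exact: cinv_dom.
  apply: (chart_map_inj (c := c)) => //; first exact: cinv_dom.
  by rewrite cinvK.
by rewrite /log_coord cinvK// -addrA -opprD.
Qed.

End Stabilizer.

(** * Displacement along an orbit *)

Section Displacement.
Context {R : realType} {G : groupTopologicalType} {LG : lie_group R G}.
Context {M : topologicalType} {SM : smooth_manifold R M} (a : smooth_action LG SM).
Variables (b : chart (R := R) G (mdim LG)) (c : chart (R := R) M (mdim SM)).
Hypotheses (ab : atlas LG b) (ac : atlas SM c) (b1 : cdom b 1%g).
Local Notation nu := (log_coord b).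
Local Notation L := (orbit_differential a b c).
Local Notation e0 := (cmap b 1%g).

(** Among the elements with the same effect on y as g, let g' be the one with
    the smallest coordinates v. If the displacement of y were much smaller than
    v, then v would be close to some w in the kernel of the differential at y,
    by [kernel_distance_le]; an element k of the stabilizer close to -w then
    makes g' k shorter than g', with the same effect on y. The constants do not
    depend on y because the rank of the differential does not exceed its value
    at y0. *)
Lemma orbit_displacement y0 : cimg c y0 ->
  exists C d, [/\ 0 < C, 0 < d & forall y g, `|y - y0| < d ->
    (\rank (L y) <= \rank (L y0))%N -> cdom b g -> `|nu g| < d ->
    [/\ cimg c y, cdom c (a g (cinv c y)) &
    exists g', [/\ cdom b g', `|nu g'| <= `|nu g|,
      a g' (cinv c y) = a g (cinv c y) &
      `|nu g'| <= C * `|chart_act a c g y - y|]]].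
Proof.
move=> cy0.
have [C1 [dl [C1_gt0 dl_gt0 kerP]]] := kernel_distance_le (L y0).
pose e : R := (16 * C1)^-1.
have e_gt0 : 0 < e by rewrite invr_gt0 mulr_gt0.
have [d1 d1_gt0 actP] := chart_act_strict a ab ac b1 cy0 e_gt0.
pose el := Num.min (dl / 2) (e / (mdim LG).+1%:R).
have el_gt0 : 0 < el by rewrite lt_min !divr_gt0.
have [d2 d2_gt0 LP] := orbit_differential_continuous a ab ac b1 cy0 el_gt0.
have e8_gt0 : 0 < (8^-1 : R) by rewrite invr_gt0.
have [d3 d3_gt0 stabP] := stabilizer_approx a ab ac b1 cy0 e8_gt0.
have e4_gt0 : 0 < (4^-1 : R) by rewrite invr_gt0.
have [d4 d4_gt0 mulP] := log_coord_mul ab b1 e4_gt0.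
have [d5 d5_gt0 imgP] := open_norm_ball (@cimg_open _ _ _ b) (cmap_img b1).
pose d := Num.min (Num.min d1 (d2 / 2)) (Num.min (d3 / 2) (Num.min (d4 / 2) d5)).
have d_gt0 : 0 < d by rewrite !lt_min !divr_gt0// d1_gt0 d5_gt0.
have [dd1 dd2 dd3 dd4 dd5] : [/\ d <= d1, 2 * d <= d2, 2 * d <= d3,
    2 * d <= d4 & d <= d5].
  by split; rewrite ?[2 * _]mulrC -?ler_pdivlMr// !ge_min lexx ?orbT.
exists (8 * C1), d; split=> [||y g yd rk bg gd]; rewrite ?mulr_gt0//.
have yd1 : `|y - y0| < d1 by lra.
have gd1 : `|nu g| < d1 by lra.
have [cy cgy _ _] := actP _ _ _ bg gd1 yd1 yd1.
split=> //.
(* The coordinates, no longer than those of g, of the elements that act on y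
   as g does. *)
pose Q := [set x | `|x - e0| <= `|nu g| /\ a (cinv b x) (cinv c y) = a g (cinv c y)].
have QP x : `|x - e0| <= `|nu g| -> [/\ cimg b x, cdom c (a (cinv b x) (cinv c y)) &
    nu (cinv b x) = x - e0].
  move=> Qx; have bx : cimg b x by apply: imgP; lra.
  have nx : nu (cinv b x) = x - e0 by rewrite /log_coord cinvK.
  split=> //.
  have nx1 : `|nu (cinv b x)| < d1 by rewrite nx; lra.
  by have [] := actP _ y y (cinv_dom bx) nx1 yd1 yd1.
have Qg : Q (cmap b g) by split; rewrite ?cmapK.
have cQ : compact Q.
  pose B := [set x | `|x - e0| <= `|nu g|].
  have cB : compact B by exact: compact_norm_ball.
  have clB : closed B by exact: compact_closed (@norm_hausdorff _ _) cB.
  apply: subclosed_compact cB _; last by move=> x [].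
  move=> x clQx; have Bx : B x by apply: clB; apply: closure_subset clQx => z [].
  split=> //; have [bx cx _] := QP x Bx.
  apply: (chart_map_inj (c := c)) => //; apply/eqP.
  rewrite -subr_eq0 -normr_eq0 eq_le normr_ge0 andbT leNgt; apply/negP => Fx0.
  have := orbit_coord_continuous bx cy cx => /cvgrPdist_lt /(_ _ Fx0) /clQx[z [[_ az]]].
  by rewrite /chart_act az ltxx.
have cN : {within Q, continuous (fun x => `|x - e0|)}.
  apply: continuous_subspaceT => x.
  exact: (cvg_norm (cvgB cvg_id (cvg_cst _))).
have [|x] := compact_EVT_min _ cQ cN; first by exists (cmap b g).
rewrite inE => -[xg ax] xmin.
have [bx cx nx] := QP x xg.
exists (cinv b x); rewrite nx; split=> //; first exact: cinv_dom.
set v := x - e0 in xg nx *.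
have -> : chart_act a c g y = chart_act a c (cinv b x) y by rewrite /chart_act ax.
have vd1 : `|nu (cinv b x)| < d1 by rewrite nx; lra.
have [_ _ + _] := actP _ y y (cinv_dom bx) vd1 yd1 yd1.
have yd2 : `|y - y0| < d2 by lra.
have Lyy0 := LP y yd2.
have yd3 : `|y - y0| < d3 by lra.
have {}stabP v' := stabP y v' yd3.
rewrite nx.
move: (L y) (L y0) (_ - y) kerP Lyy0 rk stabP => Ly L0 D kerP Lyy0 rk stabP DL.
have vL : `|v *m Ly - v *m L0| <= e * `|v|.
  rewrite -mulmxBr (le_trans (mulmx_norm_le _ _))// mulrCA mulrC ler_wpM2r//.
  apply: (@le_trans _ _ ((mdim LG)%:R * (e / (mdim LG).+1%:R))).
    by rewrite ler_wpM2l// (le_trans Lyy0)// ge_min lexx orbT.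
  rewrite mulrCA ler_piMr ?(ltW e_gt0)// ler_pdivrMr// mul1r ler_nat.
  exact: leqnSn.
have Dv : `|v *m Ly| <= `|D| + 2 * (e * `|v|).
  have h1 : `|v *m Ly| <= `|v *m Ly - v *m L0| + `|v *m L0|.
    by rewrite -{1}[v *m Ly](subrK (v *m L0)) ler_normD.
  have h2 : `|v *m L0| <= `|D - v *m L0| + `|D|.
    by rewrite -{1}[v *m L0](subKr D) (le_trans (ler_normB _ _))// addrC.
  apply: (le_trans h1); apply: (le_trans (lerD vL (le_trans h2 (lerD DL (lexx _))))).
  by rewrite mulr_natl mulr2n addrA addrC.
have LyL0 : `|Ly - L0| < dl.
  apply: (le_lt_trans Lyy0); rewrite gt_min; apply/orP; left; lra.
have [w wL vw] := kerP _ LyL0 rk v.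
(* With e = 1 / (16 C1), the terms in e in the bound Dv amount to at most half
   of |v Ly| in the case |v| <= 4 C1 |v Ly|. *)
have [small|big] := ltP (4 * (C1 * `|v *m Ly|)) `|v|; last first.
  rewrite -(ler_pM2l e_gt0); apply: (@le_trans _ _ (4^-1 * `|v *m Ly|)).
    rewrite (_ : 4^-1 * _ = e * (4 * (C1 * `|v *m Ly|))); last first.
      by rewrite /e; field; rewrite gt_eqF.
    by rewrite ler_wpM2l// ltW.
  have : e * `|v| <= 4^-1 * `|v *m Ly|.
    rewrite (_ : 4^-1 * _ = e * (4 * (C1 * `|v *m Ly|))); last first.
      by rewrite /e; field; rewrite gt_eqF.
    by rewrite ler_wpM2l// ltW.
  have -> : e * (8 * C1 * `|D|) = 2^-1 * `|D|.
    by rewrite /e; field; rewrite gt_eqF.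
  move: Dv; move: `|v *m Ly| (e * `|v|) `|D| => p q r pq qp; lra.
have [v0|v_neq0] := eqVneq v 0.
  by rewrite v0 normr0 !mulr_ge0// ltW.
have v_gt0 : 0 < `|v| by rewrite normr_gt0.
have wle : `|w| <= `|v| + `|v - w|.
  by rewrite -{1}[w](subKr v) (le_trans (ler_normB _ _)).
have wd3 : `|- w| < d3 by rewrite normrN; lra.
have wL' : - w *m Ly = 0 by rewrite mulNmx wL oppr0.
have [k [bk sk nk]] := stabP (- w) wL' wd3.
rewrite normrN opprK in nk.
have kle : `|nu k| <= `|nu k + w| + `|w|.
  by rewrite -{1}[nu k](addrK w) (le_trans (ler_normB _ _)).
have xd4 : `|nu (cinv b x)| < d4 by rewrite nx; lra.
have kd4 : `|nu k| < d4 by lra.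
have [bxk nxk] := mulP _ _ (cinv_dom bx) bk xd4 kd4.
(* At most 3/4 of the length of v remains after multiplication by k. *)
have xkv : `|nu (cinv b x * k)%g| < `|v|.
  rewrite nx in nxk.
  have : `|nu (cinv b x * k)%g| <=
      `|nu (cinv b x * k)%g - v - nu k| + (`|v - w| + `|nu k + w|).
    rewrite {1}(_ : nu (cinv b x * k)%g =
      (nu (cinv b x * k)%g - v - nu k) + ((v - w) + (nu k + w))).
      apply: (le_trans (ler_normD _ _)); apply: lerD => //; exact: ler_normD.
    move: (nu _) (nu k) => p q; by apply/rowP => i; rewrite !mxE; ring.
  lra.
have Qxk : Q (cmap b (cinv b x * k)%g).
  split; first by apply: ltW; exact: lt_le_trans xkv _.
  by rewrite cmapK// act_mul sk.
have := xmin _ (mem_set Qxk).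
by rewrite leNgt xkv.
Qed.

End Displacement.

(** * Comparing the derivatives of two lifts *)

Section GenericPoint.
Context {R : realType} {G : groupTopologicalType} {LG : lie_group R G}.
Context {M : topologicalType} {SM : smooth_manifold R M} (a : smooth_action LG SM).

(** By hypothesis the element g that moves P x to Q x is at most proportional to
    Q x - P x, so that Q x - P x = g L + o(|Q x - P x|), where L is the
    differential of the orbit map at P u. Modulo the image of L the difference
    Q - P is therefore negligible against itself near u, and its derivative
    lies in that image. *)
Lemma displaced_derivative b c m (P Q : 'rV[R]_m -> 'rV[R]_(mdim SM)) u C :
  atlas LG b -> atlas SM c -> cdom b 1%g -> cimg c (P u) -> P u = Q u ->
  differentiable P u -> differentiable Q u -> 0 < C ->
  (\forall x \near u, exists g, [/\ cdom b g, chart_act a c g (P x) = Q x &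
    `|log_coord b g| <= C * `|Q x - P x|]) ->
  forall v, exists w,
    'D_v Q u = 'D_v P u + w *m orbit_differential a b c (P u).
Proof.
move=> ab ac b1 cu PQ dP dQ C0 nearP v.
set L1 := orbit_differential a b c (P u).
suff : (('D_v Q u - 'D_v P u) <= L1)%MS.
  by move=> /submxP[w wE]; exists w; rewrite -wE addrC subrK.
rewrite submxE -normr_le0; apply/ler_addgt0Pr => e e0; rewrite add0r.
set D := Q - P.
have dD : differentiable D u by exact: differentiableB.
have -> : 'D_v Q u - 'D_v P u = 'D_v D u.
  by rewrite deriveB//; apply: diff_derivable.
set DDv := 'D_v D u.
set K := `|cokermx L1|.
have K0 : 0 <= K by rewrite /K.
(* The choice of t turns the final bound t S into one by e. *)
pose S := (mdim SM)%:R * K + (mdim SM)%:R * (C * K) * (`|DDv| + 1).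
have S0 : 0 <= S.
  apply: addr_ge0; first exact: mulr_ge0.
  apply: mulr_ge0; first by apply: mulr_ge0 => //; apply: mulr_ge0 => //; exact: ltW.
  exact: addr_ge0.
pose t : R := Num.min 1 (e / (S + 1)).
have t0 : 0 < t by rewrite lt_min ltr01/= divr_gt0// ltr_wpDl.
have [d d0 actP] := chart_act_strict a ab ac b1 cu t0.
have near_ineq : \forall x \near u,
    `|D x *m cokermx L1| <= (mdim SM)%:R * (t * (C * `|D x|) * K).
  have cP := differentiable_continuous dP.
  have cD := differentiable_continuous dD.
  have D0 : D u = 0 by rewrite /D/= -[(Q - P) u]/(Q u - P u) PQ subrr.
  have dC : 0 < d / C by rewrite divr_gt0.
  move/cvgrPdist_lt : cD => /(_ _ dC) nD.
  move/cvgrPdist_lt : cP => /(_ _ d0) nP.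
  near=> x.
  have [g [bg gP ng]] : exists g, [/\ cdom b g, chart_act a c g (P x) = Q x &
    `|log_coord b g| <= C * `|Q x - P x|] by near: x.
  have Px : `|P x - P u| < d by rewrite distrC; near: x.
  have Dx : `|D x| < d / C.
    rewrite -[D x]subr0 -D0 distrC; near: x; exact: nD.
  have ngd : `|log_coord b g| < d.
    by apply: (le_lt_trans ng); rewrite mulrC -ltr_pdivlMr.
  have [_ _ + _] := actP _ _ _ bg ngd Px Px.
  rewrite gP -/L1 => le_t.
  have -> : D x *m cokermx L1 = (Q x - P x - log_coord b g *m L1) *m cokermx L1.
    by rewrite [in RHS]mulmxBl -mulmxA mulmx_coker mulmx0 subr0.
  rewrite (le_trans (mulmx_norm_le _ _))// ler_wpM2l// ler_wpM2r//.
  by rewrite (le_trans le_t)// ler_wpM2l// ltW.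
have cD : (fun h : R => h^-1 *: (D (h *: v + u) - D u)) @ 0^' --> DDv.
  exact: diff_derivable.
have [h [h0 hD hI]] : exists h : R, [/\ h != 0,
    `|DDv - h^-1 *: (D (h *: v + u) - D u)| < t &
    `|D (h *: v + u) *m cokermx L1| <= (mdim SM)%:R * (t * (C * `|D (h *: v + u)|) * K)].
  have cu' : (fun h : R => h *: v + u) @ (0 : R) --> u.
    rewrite -[X in _ --> X]add0r -(scale0r v).
    exact: (cvgD (@scalel_continuous _ _ _ _) (cvg_cst _)).
  have n1 : \forall h \near (0 : R)^', h != 0 by exact: nbhs_dnbhs_neq.
  have n2 : \forall h \near (0 : R)^', `|DDv - h^-1 *: (D (h *: v + u) - D u)| < t.
    by move/cvgrPdist_lt : cD; exact.
  have n3 : \forall h \near (0 : R)^', `|D (h *: v + u) *m cokermx L1| <=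
      (mdim SM)%:R * (t * (C * `|D (h *: v + u)|) * K).
    by apply: nbhs_dnbhs; exact: (cu' _ near_ineq).
  have F := dnbhs_filter (0 : R).
  have [h [[h1 h2] h3]] := filter_ex (filterI (filterI n1 n2) n3).
  by exists h.
set y := D (h *: v + u) in hD hI.
have uE : D u = 0 by rewrite /D -[(Q - P) u]/(Q u - P u) PQ subrr.
rewrite uE subr0 in hD.
have hx : `|h^-1 *: y| <= `|DDv| + 1.
  have t1 : t <= 1 by rewrite /t ge_min lexx.
  rewrite -[h^-1 *: y](subKr DDv) (le_trans (ler_normB _ _))// lerD2l.
  exact: le_trans (ltW hD) t1.
have hI' : `|(h^-1 *: y) *m cokermx L1| <= (mdim SM)%:R * (t * (C * `|h^-1 *: y|) * K).
  rewrite -scalemxAl !normrZ.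
  rewrite (_ : (mdim SM)%:R * _ =
    `|h^-1| * ((mdim SM)%:R * (t * (C * `|y|) * K))); last by ring.
  by rewrite ler_wpM2l.
rewrite -[DDv in DDv *m _](subrK (h^-1 *: y)) mulmxDl (le_trans (ler_normD _ _))//.
apply: (@le_trans _ _ ((mdim SM)%:R * (t * K) + (mdim SM)%:R * (t * (C * (`|DDv| + 1)) * K))).
  apply: lerD.
    rewrite (le_trans (mulmx_norm_le _ _))// ler_wpM2l//.
    by apply: (ler_wpM2r K0); exact: ltW.
  apply: (le_trans hI'); rewrite ler_wpM2l//; apply: (ler_wpM2r K0).
  by apply: (ler_wpM2l (ltW t0)); apply: (ler_wpM2l (ltW C0)).
rewrite (_ : _ + _ = t * S); last by rewrite /S; ring.
apply: (@le_trans _ _ (e / (S + 1) * S)).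
  by rewrite ler_wpM2r// /t ge_min lexx orbT.
rewrite mulrAC ler_pdivrMr ?ltr_wpDl// ler_wpM2l ?(ltW e0)//.
by rewrite lerDl.
Unshelve. all: by end_near.
Qed.

End GenericPoint.

(** * Compactness arguments in the group *)

Section Topology.

(** A finite form of the Baire category theorem, for the sets A i that are
    relatively closed in O. Either the first one contains O, or its complement
    in O is a nonempty open set covered by the others. *)
Lemma finite_baire (T : topologicalType) (I : eqType) (s : seq I) (A : I -> set T)
    (O : set T) : open O -> O !=set0 -> (forall i, open (O `\` A i)) ->
  (forall x, O x -> exists2 i, i \in s & A i x) ->
  exists i U, [/\ open U, U !=set0, U `<=` O & U `<=` A i].
Proof.
elim: s O => [|i s IH] O oO [x Ox] oA cov; first by have [] := cov x Ox.
have [OA|] := pselect (O `<=` A i); first by exists i, O; split=> //; exists x.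
move=> /existsNP[y /not_implyP[Oy Ay]].
have [ | j | z [Oz Az] | j [U [oU U0 UO UA]]] := IH (O `\` A i) (oA i).
- by exists y.
- rewrite (_ : _ `\` A j = (O `\` A i) `&` (O `\` A j)); last first.
    apply/seteqP; split=> z; first by move=> [[Oz iz] jz]; split; split.
    by move=> [[Oz iz] [_ jz]]; split.
  by apply: openI; exact: oA.
- have [j] := cov z Oz; rewrite inE => /orP[/eqP -> // | js Aj]; by exists j.
- by exists j, U; split=> // z /UO[].
Qed.

End Topology.

Section Group.
Context {R : realType} {G : groupTopologicalType} {LG : lie_group R G}.

Lemma log_ball_open (b : chart (R := R) G (mdim LG)) d :
  open [set g | cdom b g /\ `|log_coord b g| < d].
Proof.
have := @open_preimage_at _ _ (cdom b) (cmap b) [set x | `|x - cmap b 1%g| < d].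
apply; [exact: cdom_open|by move=> x; exact: chart_map_continuous|].
apply: (@open_comp _ _ (fun x : 'rV[R]_(mdim LG) => `|x - cmap b 1%g|) [set t | t < d]).
  by move=> x _; apply: (cvg_norm (cvgB cvg_id (cvg_cst _))).
exact: open_lt.
Qed.

(** W is the image of a small closed ball of coordinates: its compactness makes
    the sets of [act_related_closed] closed, and two of its elements differ by
    an element near 1. *)
Lemma small_quotients_compact_nbhs (b : chart (R := R) G (mdim LG)) d :
  cdom b 1%g -> 0 < d -> exists W V : set G,
    [/\ compact W, open V, V 1%g, V `<=` W &
    forall g h, W g -> W h -> cdom b (g^-1 * h)%g /\ `|log_coord b (g^-1 * h)%g| < d].
Proof.
move=> b1 d0.
pose N := [set g | cdom b g /\ `|log_coord b g| < d].
have N1 : nbhs (1%g : G) N.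
  apply: open_nbhs_nbhs; split; first exact: log_ball_open.
  by split; rewrite ?log_coord1 ?normr0.
have cf : continuous (fun z : G * G => (z.1^-1 * z.2)%g).
  move=> z; apply: (@continuous_comp _ _ _ (fun z : G * G => ((z.1^-1)%g, z.2))
    (fun z : G * G => (z.1 * z.2)%g)); last exact: (lie_mul_smooth LG).1.
  have ci := (lie_inv_smooth LG).1.
  have cl : {for z, continuous (fun z : G * G => (z.1^-1)%g)}.
    by apply: (@continuous_comp _ _ _ fst (fun g : G => (g^-1)%g)); [exact: cvg_fst|exact: ci].
  have cr : {for z, continuous (fun z : G * G => z.2)} by exact: cvg_snd.
  exact: (cvg_pair cl cr).
have : nbhs ((1%g, 1%g) : G * G) [set z | N (z.1^-1 * z.2)%g].
  by apply: (cf (1%g, 1%g)); rewrite /= invg1 mulg1.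
move=> [[U1 U2] /= [nU1 nU2] U12].
have ci := chart_inv_continuous (cmap_img b1).
have nI : nbhs (cmap b 1%g) (cimg b).
  by apply: open_nbhs_nbhs; split; [exact: cimg_open|exact: cmap_img].
have nU : nbhs (cmap b 1%g) (cinv b @^-1` (U1 `&` U2)).
  by apply: ci; rewrite cmapK//; exact: filterI.
have /nbhs_ballP[r /= r0 Hr] := @filterI _ _ (nbhs_filter _) _ _ nI nU.
have Hr' x : `|x - cmap b 1%g| <= r / 2 -> cimg b x /\ (U1 `&` U2) (cinv b x).
  move=> xr; apply: Hr; rewrite -ball_normE/= distrC.
  by apply: (le_lt_trans xr); rewrite ltr_pdivrMr// ltr_pMr// ltr1n.
pose B := [set x | `|x - cmap b 1%g| <= r / 2].
exists (cinv b @` B), [set g | cdom b g /\ `|log_coord b g| < r / 2]; split.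
- apply: continuous_compact; last exact: compact_norm_ball.
  apply/continuous_in_subspaceT => x; rewrite inE => /Hr'[bx _].
  exact: chart_inv_continuous.
- exact: log_ball_open.
- by split=> //; rewrite log_coord1 normr0 divr_gt0.
- move=> g [bg gr]; exists (cmap b g); last exact: cmapK.
  exact: ltW.
- move=> _ _ [x Bx <-] [y By <-].
  have [_ [x1 x2]] := Hr' x Bx; have [_ [y1 y2]] := Hr' y By.
  exact: (U12 (cinv b x, cinv b y)).
Qed.

(** Compactness is used in its near-covering form, for the filter on finite
    sequences generated by the sets of all extensions of a given one. *)
Lemma compact_translate_cover (V : set G) : compact [set: G] -> open V -> V 1%g ->
  exists s : seq G, forall h, exists2 g, g \in s & V (g^-1 * h)%g.
Proof.
move=> /compact_near_coveringP cG oV V1.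
pose F : set_system (seq G) :=
  fun P => exists s0 : seq G, forall s : seq G, {subset s0 <= s} -> P s.
have FF : Filter F.
  split; first by exists [::].
    move=> P Q [s Ps] [t Qt]; exists (s ++ t) => r str; split.
      by apply: Ps => x xs; apply: str; rewrite mem_cat xs.
    by apply: Qt => x xt; apply: str; rewrite mem_cat xt orbT.
  by move=> P Q PQ [s Ps]; exists s => t /Ps/PQ.
have [|s Hs] := cG _ F (fun s h => exists2 g, g \in s & V (g^-1 * h)%g) FF.
  move=> h _; exists ([set h' | V (h^-1 * h')%g], [set s : seq G | h \in s]).
    split; last by exists [:: h] => s; apply; exact: mem_head.
    apply: open_nbhs_nbhs; split; last by rewrite /= mulVg.
    apply: (@open_comp _ _ (fun h' => (h^-1 * h')%g) V) => // h' _.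
    have cr : {for h', continuous (fun h => h : G)} by exact: cvg_id.
    have cl : {for h', continuous (fun _ : G => (h^-1)%g)} by exact: cst_continuous.
    apply: (@continuous_comp _ _ _ (fun h' => ((h^-1)%g, h'))
      (fun z : G * G => (z.1 * z.2)%g)).
      exact: (cvg_pair cl cr).
    exact: (lie_mul_smooth LG).1.
  by move=> [h' s] /= [Vh hs]; exists h.
by exists s => h; apply: Hs.
Qed.

Context {M : topologicalType} {SM : smooth_manifold R M} (a : smooth_action LG SM).

(** The projection of a closed set along the compact set W is closed. *)
Lemma act_related_closed (T : topologicalType) (O : set T) (P Q : T -> M)
    (W : set G) g : open O -> compact W ->
  (forall x, O x -> {for x, continuous P}) ->
  (forall x, O x -> {for x, continuous Q}) ->
  open (O `\` [set x | exists2 h, W h & Q x = a (g * h)%g (P x)]).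
Proof.
move=> oO cW cP cQ; rewrite openE => x [Ox Wx].
apply: filterI; first exact: open_nbhs_nbhs.
have ca := (act_smooth a).1.
move/compact_near_coveringP : cW => /(_ T (nbhs x) (fun x' h => Q x' <> a (g * h)%g (P x'))).
move=> /(_ (nbhs_filter x)) H.
have /H nH : forall h, W h ->
  \forall h' \near h & i \near x, Q i <> a (g * h')%g (P i).
  move=> h Wh; have neq : Q x <> a (g * h)%g (P x) by move=> E; apply: Wx; exists h.
  have := manifold_hausdorff SM; rewrite open_hausdorff => hM.
  have [[A B] [/set_mem Ax /set_mem Bx] [oA oB AB]] := hM _ _ (introN eqP neq).
  have cl : {for (h, x), continuous (fun z : G * T => (g * z.1)%g)}.
    apply: (@continuous_comp _ _ _ (fun z : G * T => (g, z.1))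
      (fun z : G * G => (z.1 * z.2)%g)).
      have c1 : {for (h, x), continuous (fun _ : G * T => g)} by exact: cst_continuous.
      have c2 : {for (h, x), continuous (fun z : G * T => z.1)} by exact: cvg_fst.
      exact: (cvg_pair c1 c2).
    exact: (lie_mul_smooth LG).1.
  have cr : {for (h, x), continuous (fun z : G * T => P z.2)}.
    by apply: (@continuous_comp _ _ _ snd P); [exact: cvg_snd|exact: cP].
  have cF : {for (h, x), continuous (fun z : G * T => a (g * z.1)%g (P z.2))}.
    apply: (@continuous_comp _ _ _ (fun z : G * T => ((g * z.1)%g, P z.2))
      (fun z : G * M => a z.1 z.2)).
      exact: (cvg_pair cl cr).
    exact: ca.
  have cQ' : {for (h, x), continuous (fun z : G * T => Q z.2)}.
    by apply: (@continuous_comp _ _ _ snd Q); [exact: cvg_snd|exact: cQ].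
  have nA : nbhs (h, x) [set z : G * T | A (Q z.2)].
    by apply: cQ'; exact: open_nbhs_nbhs.
  have nB : nbhs (h, x) [set z : G * T | B (a (g * z.1)%g (P z.2))].
    by apply: cF; exact: open_nbhs_nbhs.
  apply: filterS (filterI nA nB) => z [/= Az Bz] E.
  have : (A `&` B) (Q z.2) by split=> //; rewrite E.
  by rewrite (eqP AB).
apply: filterS nH => y Hy [h Wh]; exact: Hy.
Qed.

End Group.

(** * Generic points of a pair of lifts *)

Section GenericLift.
Context {R : realType} {G : groupTopologicalType} {LG : lie_group R G}.
Context {M : topologicalType} {SM : smooth_manifold R M} (a : smooth_action LG SM).

Lemma valLE (T : Type) (X : Type) (A : set T) (v : X) (f : A -> X) (u : A) :
  'valL_v f (\val u) = f u.
Proof. by rewrite -[in RHS](valLK v f). Qed.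

Lemma std_plot_continuous_at m (U : set 'rV[R]_m) (p : U -> M) v x :
  std_plot SM p -> U x -> {for x, continuous ('valL_v p)}.
Proof.
move=> [oU cp _] Ux; pose u : U := SigSub (mem_set Ux).
have xE : 'valL_v p x = p u by rewrite -[x]/(\val u) valLE.
move=> B nB; have {nB} : nbhs (p u) B by rewrite -xE.
rewrite nbhsE => -[W [oW Wu] WB].
have oS := std_plot_open oU cp oW.
apply: filterS (open_nbhs_nbhs (conj oS _)); last by exists u.
by move=> _ [w Ww <-]; apply: WB; rewrite valLE.
Qed.

Lemma std_plot_differentiable m (U : set 'rV[R]_m) (p : U -> M) c u :
  std_plot SM p -> atlas SM c -> cdom c (p u) ->
  differentiable ('valL_0 (cmap c \o p)) (\val u).
Proof. by move=> [_ _ sp] ac cu; have [df _] := sp c ac 1%N; apply: df; exists u. Qed.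

(** Let c be a chart at a point of the image of p, and let u0
    maximise the dimension of the orbit of p(u), among the u in O for which p(u)
    is in the domain of c; so [orbit_displacement] applies near u0.
    Let W be a small compact neighbourhood of 1. Finitely many translates g W
    cover G, so the closed sets of those u for which q(u) is in g W p(u) cover
    a neighbourhood of u0 and one of them has an interior point u1. If
    q(u1) = h^-1 p(u1) with h^-1 in g W, then near u1 the point h q(u) is the
    image of p(u) by an element near 1, and [displaced_derivative] applies. The
    same h serves for all directions v, which would fail at an arbitrary
    point: for the rotations of the plane, p the identity and q a reflection,
    there is a suitable rotation for each v at the origin, but none for all. *)
Lemma generic_lift_point m (U : set 'rV[R]_m) (p q : U -> M) (O : set 'rV[R]_m) :
  compact [set: G] -> std_plot SM p -> std_plot SM q ->
  (forall u, exists g, q u = a g (p u)) -> open O -> O `<=` U -> O !=set0 ->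
  exists (u : U) h b c, [/\ O (\val u), atlas LG b, atlas SM c & cdom b 1%g] /\
    [/\ cdom c (p u), a h (q u) = p u & forall v, exists w,
      'D_v ('valL_0 (cmap c \o (a h \o q))) (\val u) =
      'D_v ('valL_0 (cmap c \o p)) (\val u) +
        w *m orbit_differential a b c (cmap c (p u))].
Proof.
move=> cG pP qP pq oO OU [x Ox].
pose ux : U := SigSub (mem_set (OU _ Ox)).
have [c ac cux] := atlas_cover SM (p ux).
have [b ab b1] := atlas_cover LG 1%g.
pose P := 'valL_(p ux) p; pose Q := 'valL_(p ux) q.
have PE u : P (\val u) = p u by exact: valLE.
have QE u : Q (\val u) = q u by exact: valLE.
have cP y : U y -> {for y, continuous P} by exact: std_plot_continuous_at.
have cQ y : U y -> {for y, continuous Q} by exact: std_plot_continuous_at.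
pose L y := orbit_differential a b c (cmap c (P y)).
pose O1 := O `&` P @^-1` cdom c.
have oO1 : open O1.
  by apply: open_preimage_at (cdom_open c) => // y /OU; exact: cP.
have O1U y : O1 y -> U y by move=> [/OU].
have O1x : O1 x by split=> //; rewrite /preimage/= -[x]/(\val ux) PE.
(* The dimension of the orbit is largest at x0. *)
have [x0 O1x0 x0max] : exists2 x0, O1 x0 &
    forall y, O1 y -> (\rank (L y) <= \rank (L x0))%N.
  pose T n := `[< exists2 y, O1 y & \rank (L y) = n >].
  have exT : exists n, T n by exists (\rank (L x)); apply/asboolP; exists x.
  have ubT n : T n -> (n <= mdim LG)%N by move=> /asboolP[y _ <-]; exact: rank_leq_row.
  case: (ex_maxnP exT ubT) => r /asboolP[x0 O1x0 <-] rmax.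
  exists x0; first exact: O1x0.
  by move=> y O1y; apply: rmax; apply/asboolP; exists y.
have cx0 : cimg c (cmap c (P x0)) by apply: cmap_img; case: O1x0.
have [C [d [C0 d0 dispP]]] := orbit_displacement a ab ac b1 cx0.
pose O2 := O1 `&` (cmap c \o P) @^-1` [set z | `|z - cmap c (P x0)| < d].
have oO2 : open O2.
  have cPc y : O1 y -> {for y, continuous (cmap c \o P)}.
    move=> O1y; apply: (@continuous_comp _ _ _ P (cmap c)); first exact/cP/O1U.
    by apply: chart_map_continuous; case: O1y.
  apply: (open_preimage_at oO1 cPc).
  apply: (@open_comp _ _ (fun z : 'rV[R]_(mdim SM) => `|z - cmap c (P x0)|) [set t | t < d]).
    by move=> z _; apply: (cvg_norm (cvgB cvg_id (cvg_cst _))).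
  exact: open_lt.
have O2x0 : O2 x0 by split=> //; rewrite /preimage/= subrr normr0.
have [W [V [cW oV V1 VW WP]]] := small_quotients_compact_nbhs b1 d0.
have [s sP] := compact_translate_cover (LG := LG) cG oV V1.
have [ | g | y O2y | g [ B3 [oB3 [x1 B3x1] B32 B3W]]] := @finite_baire _ _ s
  (fun g => [set y | exists2 h, W h & Q y = a (g * h)%g (P y)]) O2 oO2.
- by exists x0.
- by apply: act_related_closed => // y [/O1U]; [move/cP|move/cQ].
- have Uy : U y by apply: O1U; case: O2y.
  pose uy : U := SigSub (mem_set Uy).
  have [h qh] := pq uy; have [g gs Vg] := sP h.
  exists g => //; exists (g^-1 * h)%g; first exact: VW.
  by rewrite mulVKg -[y]/(\val uy) QE PE.
have B3U y : B3 y -> U y by move=> /B32[/O1U].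
pose u1 : U := SigSub (mem_set (B3U _ B3x1)).
have [h1 Wh1 Qx1] := B3W _ B3x1.
(* The translation that makes the two lifts agree at x1. *)
pose h := ((g * h1)^-1)%g.
have hQ : a h (q u1) = p u1.
  by rewrite -QE -PE /= Qx1 -act_mul mulVg act_one.
have [[Ox1 cx1] _] := B32 _ B3x1.
have cu1 : cdom c (p u1) by rewrite -PE.
exists u1, h, b, c; split; first by split.
split=> //.
have hqP := act_plotP a h qP.
have Pu1 : 'valL_0 (cmap c \o p) (\val u1) = cmap c (p u1) by rewrite valLE.
rewrite -Pu1.
apply: (displaced_derivative (C := C)) => //.
- by rewrite Pu1; exact: cmap_img.
- by rewrite !valLE /= hQ.
- exact: std_plot_differentiable.
- by apply: std_plot_differentiable => //=; rewrite hQ.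
near=> y.
have B3y : B3 y.
  by near: y; exact: open_nbhs_nbhs.
have [[Oy cy] dy] := B32 _ B3y.
pose u : U := SigSub (mem_set (B3U _ B3y)).
have [h2 Wh2 Qy] := B3W _ B3y.
have [bk kd] := WP _ _ Wh1 Wh2.
have O1y : O1 y by [].
have [_ _ [g' [bg' _ g'E ng']]] := dispP _ _ dy (x0max _ O1y) bk kd.
have kE : a (h1^-1 * h2)%g (P y) = a h (Q y).
  by rewrite Qy -act_mul /h invgM -!mulgA mulKg.
have yE : 'valL_0 (cmap c \o p) y = cmap c (P y).
  by rewrite -[y]/(\val u) valLE PE.
have qE : 'valL_0 (cmap c \o (a h \o q)) y = cmap c (a h (Q y)).
  by rewrite -[y]/(\val u) valLE QE.
rewrite /= cmapK// kE in g'E.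
exists g'; split=> //; first by rewrite yE qE /chart_act cmapK// g'E.
apply: (le_trans ng').
by rewrite yE qE /chart_act /= cmapK// kE.
Unshelve. all: by end_near.
Qed.

End GenericLift.

(** * Forms on a manifold, and independence of the lift *)

Section Alternating.
Context {R : realType}.

Definition set_row k n (i : 'I_k) (v : 'rV[R]_n) (A : 'M[R]_(k, n)) : 'M[R]_(k, n) :=
  \matrix_(r, j) if r == i then v 0 j else A r j.

Lemma row_set_row k n (i : 'I_k) (v : 'rV[R]_n) A : row i (set_row i v A) = v.
Proof. by apply/rowP => j; rewrite !mxE eqxx. Qed.

Lemma row_set_row_neq k n (i j : 'I_k) (v : 'rV[R]_n) A :
  j != i -> row j (set_row i v A) = row j A.
Proof. by move=> ji; apply/rowP => l; rewrite !mxE (negPf ji). Qed.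

Lemma row'_set_row k n (i : 'I_k) (v : 'rV[R]_n) A : row' i (set_row i v A) = row' i A.
Proof. by apply/matrixP => r j; rewrite !mxE eq_sym (negPf (neq_lift _ _)). Qed.

Lemma set_row_id k n (i : 'I_k) (A : 'M[R]_(k, n)) : set_row i (row i A) A = A.
Proof. by apply/matrixP => r j; rewrite !mxE; case: eqP => // ->. Qed.

Lemma alternating_add k n (w : 'M[R]_(k, n) -> R) i u v A :
  alternating_multilinear w ->
  w (set_row i (u + v) A) = w (set_row i u A) + w (set_row i v A).
Proof.
move=> [lin _]; rewrite -[w (set_row i u A)]mul1r; apply: (lin i).
- by rewrite !row_set_row scale1r.
- by rewrite !row'_set_row.
- by rewrite !row'_set_row.
Qed.

(** A form that vanishes when its first argument is in T vanishes when any
    argument v is: with u the first argument, expand the form at u + v in both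
    of these slots, where it is zero. Then A is changed into B one row at a
    time. *)
Lemma alternating_eq_mod k n (w : 'M[R]_(k, n) -> R) (T : set 'rV[R]_n) :
  alternating_multilinear w ->
  (forall v, T v -> interior_product v w = (fun=> 0)) ->
  forall A B, (forall i, T (row i A - row i B)) -> w A = w B.
Proof.
case: k w => [|k] w alt_w hor A B TAB.
  by congr w; apply/matrixP => -[].
have hor0 v C : T v -> w (set_row ord0 v C) = 0.
  move=> Tv; have := hor v Tv => /(congr1 (fun f => f (row' ord0 C))) /= <-.
  congr w; apply/matrixP => i j; rewrite !mxE; case: splitP => r /= ri.
    by rewrite -val_eqE/= ri (ord1 r) eqxx.
  rewrite -val_eqE/= ri !mxE.
  by congr (C _ _); apply: val_inj; rewrite /= ri /bump leq0n.
have hor1 i v C : T v -> w (set_row i v C) = 0.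
  move=> Tv; have [->|i0] := eqVneq i ord0; first exact: hor0.
  have i0' : ord0 != i by rewrite eq_sym.
  (* The form vanishes when u + v stands in both rows i and ord0; expanding in
     row ord0 and then in row i leaves its value at D. *)
  set D := set_row i v C; set u := row ord0 D.
  have Dv : D = set_row i v D by rewrite -[in RHS](row_set_row i v C) set_row_id.
  have E1 : w (set_row i (u + v) D) = w D.
    rewrite alternating_add// -Dv (alt_w.2 _ ord0 i)//; first by rewrite add0r.
    by rewrite row_set_row row_set_row_neq.
  set E := set_row i (u + v) D in E1.
  have Eu : E = set_row ord0 u E.
    by rewrite -[in RHS](_ : row ord0 E = u) ?set_row_id// row_set_row_neq.
  have : w (set_row ord0 (u + v) E) = w E.
    by rewrite alternating_add// -Eu hor0// addr0.
  rewrite E1 => <-; apply: (alt_w.2 _ ord0 i) => //.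
  by rewrite row_set_row row_set_row_neq// row_set_row.
pose H j : 'M[R]_(k.+1, n) := \matrix_(r, l) if (r < j)%N then A r l else B r l.
have HS j : (j < k.+1)%N -> w (H j.+1) = w (H j).
  move=> jk; pose i := Ordinal jk.
  have -> : H j.+1 = set_row i (row i B + (row i A - row i B)) (H j).
    apply/matrixP => r l; rewrite !mxE ltnS leq_eqVlt -[r == i]val_eqE/=.
    by case: eqP => [ri|] //=; rewrite addrC subrK; congr (A _ _); exact: val_inj.
  rewrite alternating_add// (hor1 _ _ _ (TAB i)) addr0; congr w.
  rewrite -[RHS](set_row_id i); congr set_row.
  by apply/rowP => l; rewrite !mxE ltnn.
have HE j : (j <= k.+1)%N -> w (H j) = w (H 0%N).
  by elim: j => // j IH jk; rewrite HS// IH// ltnW.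
have -> : A = H k.+1 by apply/matrixP => r l; rewrite !mxE ltn_ord.
by rewrite HE//; congr w; apply/matrixP => r l; rewrite !mxE ltn0.
Qed.

Lemma alternating_row0 k n (f : 'M[R]_(k, n) -> R) i (A : 'M[R]_(k, n)) :
  alternating_multilinear f -> row i A = 0 -> f A = 0.
Proof.
move=> altf A0; have := alternating_add i 0 0 A altf.
rewrite addr0 -A0 set_row_id => /eqP.
by rewrite eq_sym -subr_eq0 addrK => /eqP.
Qed.

Lemma row0_col_mx0 k n (B : 'M[R]_(k, n)) :
  row (ord0 : 'I_k.+1) (col_mx (0 : 'rV[R]_n) B) = 0.
Proof. by apply/rowP => j; rewrite !mxE; case: splitP => // s _; rewrite mxE. Qed.

End Alternating.

Section Forms.
Context {R : realType}.

Lemma jacobian_near_eq m n (f g : 'rV[R]_m -> 'rV[R]_n) x :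
  (\near x, f x = g x) -> differentiable f x -> 'J f x = 'J g x.
Proof.
move=> fg df; have dg := near_eq_differentiable fg df.
apply/row_matrixP => i.
apply: (etrans (rowE i _)); apply: (etrans _ (esym (rowE i _))).
exact: (etrans (esym (deriveEjacobian _ df))
  (etrans (near_eq_derive _ fg) (deriveEjacobian _ dg))).
Qed.

Lemma jacobian_id m (x : 'rV[R]_m) : 'J id x = 1%:M.
Proof.
apply/row_matrixP => i; rewrite !rowE mulmx1; apply: mulmx_jacobian_affine.
  exact: ex_diff.
by apply/nbhs_ballP; exists 1 => /=.
Qed.

Lemma smooth_subset_incl n (U V : set 'rV[R]_n) (VU : V `<=` U) :
  open V -> smooth (\val \o subset_incl VU).
Proof.
move=> oV j; apply: (@Ck_eq _ _ _ _ _ id) => //; last exact: Ck_id.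
by move=> x Vx; rewrite -[x]/(\val (SigSub (mem_set Vx) : V)) valL0E.
Qed.

(** Naturality for the inclusion of V in U, whose Jacobian is the identity. *)
Lemma dform_restrict (X : Type) (D : diffeology (R := R) X) k (w : plotwise D k)
    (wP : dforms D k w) n (U V : set 'rV[R]_n) (p : U -> X) (VU : V `<=` U)
    (pP : is_plot D p) (qP : is_plot D (p \o subset_incl VU)) v A :
  w (Plot qP) v A = w (Plot pP) (subset_incl VU v) A.
Proof.
have oV := plot_open qP.
have nE : \forall z \near \val v, id z = 'valL_0 (\val \o subset_incl VU) z.
  apply: filterS (open_nbhs_nbhs (conj oV (set_valP v))) => x Vx.
  by rewrite -[x]/(\val (SigSub (mem_set Vx) : V)) valL0E.
have sV := smooth_subset_incl VU oV.
rewrite (wP.2 (Plot pP) (Plot qP) (subset_incl VU) sV erefl) /local_pullback.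
by rewrite -(jacobian_near_eq nE) ?jacobian_id ?mulmx1//; exact: ex_diff.
Qed.

End Forms.

Section ChartFormula.
Context {R : realType} {M : topologicalType} {SM : smooth_manifold R M}.

(** Naturality again, since near u the plot p is the composite of the chart
    plot of c with the coordinate expression of p. *)
Lemma dform_in_chart k (w : plotwise (std_diffeology SM) k)
    (wP : dforms (std_diffeology SM) k w) c (ac : atlas SM c) n (U : set 'rV[R]_n) (p : U -> M)
    (pP : is_plot (std_diffeology SM) p) (u : U) (y : cimg c) A :
  cdom c (p u) -> \val y = cmap c (p u) ->
  w (Plot pP) u A =
  w (chart_plot ac) y (A *m 'J ('valL_0 (cmap c \o p)) (\val u)).
Proof.
move=> cu yE; have [oU cp sp] := pP.
pose V := \val @` (p @^-1` cdom c).
have oV : open V by exact: std_plot_open (cdom_open c).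
have VU : V `<=` U by move=> _ [x _ <-]; exact: set_valP.
have sV := smooth_subset_incl VU oV.
have qP : is_plot (std_diffeology SM) (p \o subset_incl VU) := plot_comp pP oV sV.
have Vc (x : V) : cdom c (p (subset_incl VU x)).
  have [x' cx' xx'] := set_valP x.
  by rewrite (_ : subset_incl VU x = x')//; exact: val_inj.
have Vu : V (\val u) by exists u.
pose v : V := SigSub (mem_set Vu).
have vE : subset_incl VU v = u by exact: val_inj.
rewrite -{1}vE -(dform_restrict wP pP (qP := qP)).
pose F (x : V) : cimg c := SigSub (mem_set (cmap_img (Vc x))).
have FE : forall x, V x -> 'valL_0 (cmap c \o p) x = 'valL_0 (\val \o F) x.
  move=> x Vx; rewrite -[x]/(\val (SigSub (mem_set Vx) : V)) valL0E.
  by rewrite -[\val _]/(\val (subset_incl VU (SigSub (mem_set Vx)))) valL0E.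
have sF : smooth (\val \o F).
  by move=> j; apply: (Ck_eq oV FE); exact: (sp c ac j).
have qF : p \o subset_incl VU = @Defs.pmap _ _ _ (chart_plot ac) \o F.
  by apply/funext => x; rewrite /= /sigL/= cmapK.
rewrite (wP.2 (chart_plot ac) (Plot qP) F sF qF) /local_pullback.
have -> : F v = y by apply: val_inj; rewrite yE /= vE.
apply: (congr1 (fun J => w (chart_plot ac) y (A *m J))).
apply/esym/jacobian_near_eq.
  exact: filterS (open_nbhs_nbhs (conj oV Vu)).
exact: std_plot_differentiable pP ac cu.
Qed.

End ChartFormula.

Section LiftIndependence.
Context {R : realType} {G : groupTopologicalType} {LG : lie_group R G}.
Context {M : topologicalType} {SM : smooth_manifold R M} (a : smooth_action LG SM).

Lemma chart_map2_derive_left (b : chart (R := R) G (mdim LG))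
    (c : chart (R := R) M (mdim SM)) y v :
  'D_v (cmap c \o (fun g => a g (cinv c y)) \o cinv b) (cmap b 1%g) =
  'D_(row_mx v 0) (chart_map2 a b c c) (row_mx (cmap b 1%g) y).
Proof.
pose F := chart_map2 a b c c; pose e := row_mx (cmap b 1%g) y.
rewrite /derive (_ : (fun h => _) = fun h : R =>
  h^-1 *: ((F \o shift e) (h *: row_mx v 0) - F e))//; apply/funext => h.
by rewrite /F /e /= /chart_map2 scale_row_mx add_row_mx scaler0 add0r !row_mxKl !row_mxKr.
Qed.

Lemma orbit_differential_tangent b c y v :
  atlas LG b -> atlas SM c -> cdom b 1%g -> cimg c y ->
  orbit_tangent a (cinv c y) c (v *m orbit_differential a b c y).
Proof.
move=> ab ac b1 cy; exists b; split=> //; exists v.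
rewrite chart_map2_derive_left deriveEjacobian ?row_mx0_mul//.
have [_ sa] := act_smooth a; have [df _] := sa _ _ _ ab ac ac 1%N.
apply: df; split; rewrite ?row_mxKl ?row_mxKr//; first exact: cmap_img.
by rewrite cmapK// act_one; exact: cinv_dom.
Qed.

(** The values of both forms at u are smooth in u, so that it suffices to find a
    point where they agree in each nonempty open set. At the point of
    [generic_lift_point], invariance allows q to be replaced by h q; the
    derivatives of p and h q then agree modulo vectors tangent to the orbit,
    which a horizontal form ignores. *)
Lemma basic_form_lift_eq k (w : plotwise (std_diffeology SM) k) n (U : set 'rV[R]_n)
    (p q : U -> M) (pP : is_plot (std_diffeology SM) p)
    (qP : is_plot (std_diffeology SM) q) :
  compact [set: G] -> basic_forms a k w ->
  (forall u, exists g, q u = a g (p u)) -> w (Plot pP) = w (Plot qP).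
Proof.
move=> cG [wD wI wH] pq; apply/funext => u; apply/funext => A.
have oU := plot_open pP.
have sp : smooth (fun u => w (Plot pP) u A) := (wD.1 (Plot pP)).2 A.
have sq : smooth (fun u => w (Plot qP) u A) := (wD.1 (Plot qP)).2 A.
pose f := 'valL_0 (fun u => w (Plot pP) u A) - 'valL_0 (fun u => w (Plot qP) u A).
have fE (v : U) : f (\val v) = w (Plot pP) v A - w (Plot qP) v A.
  by rewrite /f !fctE !valL0E.
have cf x : U x -> {for x, continuous f}.
  by move=> Ux; apply: continuousB; [exact: (sp 0%N)|exact: (sq 0%N)].
pose O := U `&` f @^-1` [set t | t != 0].
have oO : open O by apply: open_preimage_at => //; exact: open_neq.
have OU : O `<=` U by move=> x [].
apply/eqP; rewrite -subr_eq0 -fE; apply/negPn/negP => fu.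
have O0 : O !=set0 by exists (\val u); split=> //; exact: set_valP.
have [v [h [b [c [[Ov ab ac b1] [cv hv Dv]]]]]] := generic_lift_point cG pP qP pq oO OU O0.
have [_ /= /eqP] := Ov; apply.
rewrite fE; apply/eqP; rewrite subr_eq0; apply/eqP.
pose hqP := act_plotP a h qP.
have -> : w (Plot qP) v A = w (Plot hqP) v A by rewrite -[in LHS](wI h).
have cy := cmap_img cv.
pose y : cimg c := SigSub (mem_set cy).
have yE : \val y = cmap c (p v) by [].
rewrite (dform_in_chart wD ac A cv yE).
have chv : cdom c ((a h \o q) v) by rewrite /= hv.
have yE' : \val y = cmap c ((a h \o q) v) by rewrite /= hv.
rewrite (dform_in_chart (pP := hqP) wD ac A chv yE').
apply/esym/alternating_eq_mod.
- exact: (wD.1 (chart_plot ac)).1 y.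
- exact: wH.
move=> i.
have E1 := etrans (row_mul i A _)
  (esym (deriveEjacobian (row i A) (std_plot_differentiable hqP ac chv))).
have E2 := etrans (row_mul i A _)
  (esym (deriveEjacobian (row i A) (std_plot_differentiable pP ac cv))).
have [z Dz] := Dv (row i A).
have addKl (s t : 'rV[R]_(mdim SM)) : s + t - s = t by rewrite addrAC subrr add0r.
have Ez := etrans (congr1 (fun s => s - _) Dz) (addKl _ _).
apply: (eq_ind_r (orbit_tangent a (cinv c (\val y)) c) _
  (etrans (congr2 (fun s t => s - t) E1 E2) Ez)).
exact: orbit_differential_tangent.
Qed.

End LiftIndependence.

(** * Pullback of forms on the orbit space *)

Section Pullback.
Local Open Scope quotient_scope.
Context {R : realType}.

Lemma plotwise_congr (X : Type) (D : diffeology (R := R) X) k (w : plotwise D k)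
    n (U : set 'rV[R]_n) (p q : U -> X) (pP : is_plot D p) (qP : is_plot D q) :
  p = q -> w (Plot pP) = w (Plot qP).
Proof.
by move=> pq; subst q; rewrite (Prop_irrelevance pP qP).
Qed.

Lemma dforms_pullback (X Y : Type) (DX : diffeology (R := R) X)
    (DY : diffeology (R := R) Y) (F : dmap DX DY) k (w : plotwise DY k) :
  dforms DY k w -> dforms DX k (form_pullback F w).
Proof.
move=> [wk wF]; split=> [p|p q f sf qp]; first exact: (wk (push_plot F p)).
by apply: (wF (push_plot F p) (push_plot F q) f sf); rewrite /= qp.
Qed.

Context {G : groupTopologicalType} {LG : lie_group R G}.
Context {M : topologicalType} {SM : smooth_manifold R M} (a : smooth_action LG SM).

Lemma orbit_pi_eq (x y : M) :
  \pi_(orbit_space a) x = \pi_(orbit_space a) y <-> exists g, y = a g x.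
Proof.
split; first by move=> /eqmodP/asboolP.
by move=> xy; apply/eqmodP/asboolP.
Qed.

Lemma pullback_invariant k (w : plotwise (orbit_diffeology a) k) :
  invariant_form a (form_pullback (orbit_map a) w).
Proof.
move=> g; apply: functional_extensionality_dep => -[n U p pP].
apply: (plotwise_congr w (dmapP (orbit_map a) (dmapP (act_dmap a g) pP))
  (dmapP (orbit_map a) pP)).
by apply/funext => u; apply/esym/orbit_pi_eq; exists g.
Qed.

Lemma rsubmx_smooth m n (A : set 'rV[R]_(m + n)) :
  open A -> smooth_on A (rsubmx : 'rV[R]_(m + n) -> 'rV[R]_n).
Proof.
move=> oA j.
apply: (@Ck_lin _ _ _ _ j A (@rsubmx R 1 m n) id oA); last exact: Ck_id.
exact: continuous_rsubmx.
Qed.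

Lemma differentiable_rsubmx m n (z : 'rV[R]_(m + n)) :
  differentiable (@rsubmx R 1 m n) z.
Proof. by have [df _] := rsubmx_smooth (@openT 'rV[R]_(m + n)) 1%N; exact: (df z I). Qed.

Lemma mulmx_jacobian_rsubmx m n (z r : 'rV[R]_(m + n)) :
  r *m 'J (@rsubmx R 1 m n) z = rsubmx r.
Proof.
apply: (mulmx_jacobian_affine (differentiable_rsubmx z)).
by apply/nbhs_ballP; exists 1 => //= t _; rewrite linearD linearZ.
Qed.

(** Let F(g, x) = g x and let P(g, x) = x. Composed with pi they are the same
    plot, so F and P pull the form back to the same form on the product of G
    and M. A vector v tangent to the orbit of x is the image by the
    differential of F of a vector in the direction of G, which P kills. *)
Lemma pullback_horizontal k (w : plotwise (orbit_diffeology a) k) :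
  dforms (orbit_diffeology a) k w ->
  horizontal a (form_pullback (orbit_map a) w).
Proof.
case: k w => [|k] w wD c ac u v; first by [].
move=> [b [ab b1 [z vE]]]; apply/funext => B /=.
rewrite chart_map2_derive_left in vE.
set w' := form_pullback (orbit_map a) w.
have w'D : dforms (std_diffeology SM) k.+1 w' by exact: dforms_pullback.
pose e0 := cmap b 1%g; pose y := \val u.
have cy : cimg c y := set_valP u.
have [ca sa] := act_smooth a.
pose H := chart_map2 a b c c; pose E := chart_map2_dom a b c c.
have oE : open E by exact: chart_map2_dom_open.
have sH : smooth_on E H := sa _ _ _ ab ac ac.
pose z0 := row_mx e0 y.
have Ez0 : E z0.
  split; rewrite ?row_mxKl ?row_mxKr//; first exact: cmap_img.
  by rewrite cmapK// act_one; exact: cinv_dom.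
have HE x : cimg c x -> H (row_mx e0 x) = x.
  by move=> cx; rewrite /H /chart_map2 row_mxKl row_mxKr cmapK// act_one cinvK.
have Hz0 : H z0 = y := HE y cy.
have dH : differentiable H z0 by have [df _] := sH 1%N; exact: df.
have EH (x : E) : cimg c (H (\val x)) by have [_ _ /cmap_img] := set_valP x.
have Er (x : E) : cimg c (rsubmx (\val x)) by have [] := set_valP x.
pose F (x : E) : cimg c := SigSub (mem_set (EH x)).
pose P (x : E) : cimg c := SigSub (mem_set (Er x)).
have FE x : E x -> H x = 'valL_0 (\val \o F) x.
  by move=> Ex; rewrite -[x]/(\val (SigSub (mem_set Ex) : E)) valL0E.
have PE x : E x -> rsubmx x = 'valL_0 (\val \o P) x.
  by move=> Ex; rewrite -[x]/(\val (SigSub (mem_set Ex) : E)) valL0E.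
have sF : smooth (\val \o F) by move=> j; exact: (Ck_eq oE FE).
have sP : smooth (\val \o P).
  by move=> j; apply: (Ck_eq oE PE); exact: rsubmx_smooth.
have cP := chart_plotP ac.
have FP := plot_comp cP oE sF; have PP := plot_comp cP oE sP.
have wFP : w' (Plot FP) = w' (Plot PP).
  apply: (plotwise_congr w (dmapP (orbit_map a) FP) (dmapP (orbit_map a) PP)).
  apply/funext => x; apply/esym/orbit_pi_eq.
  exists (cinv b (lsubmx (\val x))).
  by have [_ _ xc] := set_valP x; rewrite /= /sigL/= /H /chart_map2 cmapK.
rewrite (w'D.2 (chart_plot ac) (Plot FP) F sF erefl) in wFP.
rewrite (w'D.2 (chart_plot ac) (Plot PP) P sP erefl) in wFP.
pose x0 : E := SigSub (mem_set Ez0).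
have Fx0 : F x0 = u by apply: val_inj; rewrite /= Hz0.
have Px0 : P x0 = u by apply: val_inj; rewrite /= row_mxKr.
have nE := open_nbhs_nbhs (conj oE Ez0).
have JF : 'J ('valL_0 (\val \o F)) (\val x0) = 'J H z0.
  by apply/esym/(jacobian_near_eq _ dH); exact: filterS nE.
have dr := differentiable_rsubmx z0.
have JP : 'J ('valL_0 (\val \o P)) (\val x0) = 'J (@rsubmx R 1 (mdim LG) (mdim SM)) z0.
  by apply/esym/(jacobian_near_eq _ dr); exact: filterS nE.
have JHr (r : 'rV[R]_(mdim SM)) : row_mx 0 r *m 'J H z0 = r.
  apply: (mulmx_jacobian_affine dH).
  have [d d0 Hd] := open_norm_ball (@cimg_open _ _ _ c) cy.
  apply: filterS (near0_scale_lt r d0) => t td.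
  have -> : z0 + t *: row_mx 0 r = row_mx e0 (y + t *: r).
    by rewrite /z0 scale_row_mx scaler0 add_row_mx addr0.
  rewrite Hz0; apply: HE; apply: Hd.
  by rewrite [y + _]addrC addrK.
have JPr := mulmx_jacobian_rsubmx z0.
have JHB : (row_mx 0 B : 'M[R]_(k, mdim LG + mdim SM)) *m 'J H z0 = B.
  apply/row_matrixP => i; rewrite row_mul row_row_mx row0; exact: JHr.
(* The first row is the direction of G that F maps to v; the others are
   directions of M. *)
pose A : 'M[R]_(1 + k, mdim LG + mdim SM) := col_mx (row_mx z 0) (row_mx 0 B).
have AF : A *m 'J ('valL_0 (\val \o F)) (\val x0) = col_mx v B.
  apply: etrans (congr1 (mulmx A) JF) _; apply: etrans (mul_col_mx _ _ _) _.
  exact: (congr2 col_mx (etrans (esym (deriveEjacobian _ dH)) (esym vE)) JHB).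
have AP : A *m 'J ('valL_0 (\val \o P)) (\val x0) = col_mx 0 B.
  apply: etrans (congr1 (mulmx A) JP) _.
  apply: etrans (mul_col_mx _ _ _) _; congr col_mx.
    by apply: etrans (JPr _) _; rewrite row_mxKr.
  apply/row_matrixP => i; apply: etrans (row_mul _ _ _) _.
  by apply: etrans (JPr _) _; rewrite row_row_mx row0 row_mxKr.
have W := congr1 (fun f => f x0 A) wFP.
have W' : w' (chart_plot ac) u (col_mx v B) =
    w' (chart_plot ac) u (col_mx (0 : 'rV[R]_(mdim SM)) B) :=
  etrans (esym (congr2 (w' (chart_plot ac)) Fx0 AF))
    (etrans W (congr2 (w' (chart_plot ac)) Px0 AP)).
apply: (etrans W'); apply: (alternating_row0 (i := ord0)).
  exact: ((w'D.1 (chart_plot ac)).1 u).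
exact: row0_col_mx0.
Qed.

(** Every plot of M/G is locally the image of a plot of M. *)
Lemma pullback_injective k (w1 w2 : plotwise (orbit_diffeology a) k) :
  dforms (orbit_diffeology a) k w1 -> dforms (orbit_diffeology a) k w2 ->
  form_pullback (orbit_map a) w1 = form_pullback (orbit_map a) w2 -> w1 = w2.
Proof.
move=> w1D w2D w12; apply: functional_extensionality_dep => -[n U p pP].
apply/funext => u; apply/funext => A.
have [oU /(_ u)[V [VU [oV Vu [q qP pq]]]]] := pP.
pose v : V := SigSub (mem_set Vu).
have vE : subset_incl VU v = u by exact: val_inj.
pose qP' := dmapP (orbit_map a) qP.
have pP' : is_plot (orbit_diffeology a) (p \o subset_incl VU) by rewrite pq.
rewrite -vE -(dform_restrict w1D pP (qP := pP')) -(dform_restrict w2D pP (qP := pP')).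
have E (w : plotwise (orbit_diffeology a) k) :
    w (Plot pP') = w (Plot qP') :> covector_field V k.
  exact: (plotwise_congr w pP' qP' pq).
rewrite !E.
exact: (congr1 (fun w : plotwise (std_diffeology SM) k => w (Plot qP) v A) w12).
Qed.

End Pullback.

(** * Descent of basic forms *)

Section Descent.
Local Open Scope quotient_scope.
Context {R : realType} {G : groupTopologicalType} {LG : lie_group R G}.
Context {M : topologicalType} {SM : smooth_manifold R M} (a : smooth_action LG SM).

(** The possible values at u of the form induced by w, computed with the local
    lifts of p to M. It is a relation because no lift is canonical; it turns
    out to be a function when w is basic. *)
Definition lift_value k (w : plotwise (std_diffeology SM) k) n (U : set 'rV[R]_n)
    (p : U -> orbit_space a) (u : U) (f : 'M[R]_(k, n) -> R) : Prop :=
  exists (V : set 'rV[R]_n) (VU : V `<=` U) (v : V) (q : V -> M)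
    (qP : is_plot (std_diffeology SM) q),
    [/\ subset_incl VU v = u, p \o subset_incl VU = \pi_(orbit_space a) \o q &
        f = w (Plot qP) v].

Lemma lift_value_exists k (w : plotwise (std_diffeology SM) k) n
    (U : set 'rV[R]_n) (p : U -> orbit_space a) u :
  is_plot (orbit_diffeology a) p -> exists f, lift_value w p u f.
Proof.
move=> [oU /(_ u)[V [VU [oV Vu [q qP pq]]]]].
exists (w (Plot qP) (SigSub (mem_set Vu))), V, VU, (SigSub (mem_set Vu)), q, qP.
by split=> //; exact: val_inj.
Qed.

Lemma lift_value_unique k (w : plotwise (std_diffeology SM) k) n
    (U : set 'rV[R]_n) (p : U -> orbit_space a) u f1 f2 :
  compact [set: G] -> basic_forms a k w ->
  lift_value w p u f1 -> lift_value w p u f2 -> f1 = f2.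
Proof.
move=> cG wB [V1 [VU1 [v1 [q1 [qP1 [vu1 pq1 ->]]]]]] [V2 [VU2 [v2 [q2 [qP2 [vu2 pq2 ->]]]]]].
have oV : open (V1 `&` V2) by apply: openI; [exact: plot_open qP1|exact: plot_open qP2].
have I1 : V1 `&` V2 `<=` V1 by move=> x [].
have I2 : V1 `&` V2 `<=` V2 by move=> x [].
have qP1' : is_plot (std_diffeology SM) (q1 \o subset_incl I1).
  exact: (plot_comp qP1 oV (smooth_subset_incl I1 oV)).
have qP2' : is_plot (std_diffeology SM) (q2 \o subset_incl I2).
  exact: (plot_comp qP2 oV (smooth_subset_incl I2 oV)).
have u1 : \val v1 = \val u by rewrite -vu1.
have u2 : \val v2 = \val u by rewrite -vu2.
have Vu : (V1 `&` V2) (\val u).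
  by split; [rewrite -u1|rewrite -u2]; exact: set_valP.
pose v : (V1 `&` V2)%classic := SigSub (mem_set Vu).
have E1 : subset_incl I1 v = v1 by apply: val_inj; rewrite /= u1.
have E2 : subset_incl I2 v = v2 by apply: val_inj; rewrite /= u2.
have wD : dforms (std_diffeology SM) k w by case: wB.
apply/funext => A.
rewrite -E1 -E2 -(dform_restrict wD qP1 (qP := qP1')) -(dform_restrict wD qP2 (qP := qP2')).
have -> // : w (Plot qP1') = w (Plot qP2').
apply: basic_form_lift_eq cG wB _ => x; apply/orbit_pi_eq.
have := congr1 (fun f => f (subset_incl I1 x)) pq1.
have := congr1 (fun f => f (subset_incl I2 x)) pq2 => /= <- <-.
by congr p; exact: val_inj.
Qed.

Definition descended_form k (w : plotwise (std_diffeology SM) k) :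
    plotwise (orbit_diffeology a) k :=
  fun p u => projT1 (cid (lift_value_exists w u (plotP p))).

Context (compactG : compact [set: G]) (k : nat).

Lemma descended_formE (w : plotwise (std_diffeology SM) k) n (U V : set 'rV[R]_n)
    (p : U -> orbit_space a) (pP : is_plot (orbit_diffeology a) p) (VU : V `<=` U)
    (q : V -> M) (qP : is_plot (std_diffeology SM) q) v :
  basic_forms a k w -> p \o subset_incl VU = \pi_(orbit_space a) \o q ->
  descended_form w (p := Plot pP) (subset_incl VU v) = w (Plot qP) v.
Proof.
move=> wB pq; rewrite /descended_form; case: cid => f /= fP.
apply: (lift_value_unique compactG wB fP).
by exists V, VU, v, q, qP.
Qed.

(** Near each point the form is computed from one fixed lift, hence is smooth
    there; and if r lifts p, then r o F lifts p o F. *)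
Lemma descended_dform (w : plotwise (std_diffeology SM) k) :
  basic_forms a k w -> dforms (orbit_diffeology a) k (descended_form w).
Proof.
move=> wB; have [wD _ _] := wB; split.
  move=> [n U p pP]; have oU := plot_open pP; split.
    move=> u; have [_ /(_ u)[V [VU [oV Vu [q qP pq]]]]] := pP.
    have uE : u = subset_incl VU (SigSub (mem_set Vu)) by exact: val_inj.
    by rewrite uE (descended_formE pP qP _ wB pq); exact: ((wD.1 (Plot qP)).1 _).
  move=> A j; apply: Ck_locally => x Ux.
  have [_ /(_ (SigSub (mem_set Ux)))[V [VU [oV Vu [q qP pq]]]]] := pP.
  exists V => //; apply: (Ck_eq oV _ ((wD.1 (Plot qP)).2 A j)).
  move=> y Vy; rewrite -[y]/(\val (SigSub (mem_set Vy) : V)) valL0E.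
  rewrite -[\val _]/(\val (subset_incl VU (SigSub (mem_set Vy)))) valL0E.
  by rewrite (descended_formE pP qP _ wB pq).
move=> [n U p pP] [m V q qP] F /= sF qpF; apply/funext => v; apply/funext => A.
have oV := plot_open qP.
have [_ /(_ (F v))[U' [UU' [oU' UFv [r rP pr]]]]] := pP.
pose V' := V `&` 'valL_0 (\val \o F) @^-1` U'.
have oV' : open V' := open_preimage_at oV (sF 0%N) oU'.
have VV' : V' `<=` V by move=> x [].
have FU (x : V') : U' (\val (F (subset_incl VV' x))).
  have [_] := set_valP x.
  by rewrite /preimage/mkset -[\val x]/(\val (subset_incl VV' x)) valL0E.
have V'v : V' (\val v).
  by split; [exact: set_valP|rewrite /preimage/mkset valL0E].
pose F' (x : V') : U' := SigSub (mem_set (FU x)).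
have FF' x : F (subset_incl VV' x) = subset_incl UU' (F' x) by exact: val_inj.
have sF' : smooth (\val \o F') by exact: (smooth_incl VV' oV' sF).
have rP' := plot_comp rP oV' sF'.
pose v' : V' := SigSub (mem_set V'v).
have vE : subset_incl VV' v' = v by exact: val_inj.
have qr : q \o subset_incl VV' = \pi_(orbit_space a) \o (r \o F').
  rewrite qpF; apply/funext => x /=; rewrite FF'.
  exact: (congr1 (fun f => f (F' x)) pr).
rewrite -vE (descended_formE qP rP' _ wB qr) /local_pullback FF'.
rewrite (descended_formE pP rP _ wB pr).
rewrite (wD.2 (Plot rP) (Plot rP') F' sF' erefl) /local_pullback.
apply: (congr1 (fun J => w (Plot rP) (F' v') (A *m J))).
apply/esym/jacobian_near_eq.
  apply: filterS (open_nbhs_nbhs (conj oV' V'v)) => x V'x.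
  rewrite -[x]/(\val (SigSub (mem_set V'x) : V')) valL0E.
  by rewrite -[\val _]/(\val (subset_incl VV' (SigSub (mem_set V'x)))) valL0E.
by have [df _] := sF 1%N; apply: df; exact: set_valP.
Qed.

Lemma pullback_descended_form (w : plotwise (std_diffeology SM) k) :
  basic_forms a k w -> form_pullback (orbit_map a) (descended_form w) = w.
Proof.
move=> wB; apply: functional_extensionality_dep => -[n U p pP].
apply/funext => u.
have uE : u = subset_incl (@subset_refl _ U) u by exact: val_inj.
rewrite {1}uE; apply: (descended_formE _ pP u wB).
by apply/funext => v /=; congr (\pi_(orbit_space a) (p _)); exact: val_inj.
Qed.

End Descent.

Theorem theorem3p20 (R : realType)
  (G : groupTopologicalType) (LG : lie_group R G)
  (M : topologicalType) (SM : smooth_manifold R M)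
  (a : smooth_action LG SM) (compactG : compact [set: G]) :
  [/\ forall k : nat,
        set_bij (dforms (orbit_diffeology a) k) (basic_forms a k)
                (form_pullback (orbit_map a) (k := k)),
      forall (k : nat) (c : R) (w1 w2 : plotwise (orbit_diffeology a) k),
        dforms (orbit_diffeology a) k w1 -> dforms (orbit_diffeology a) k w2 ->
        form_pullback (orbit_map a) (form_lincomb c w1 w2) =
        form_lincomb c (form_pullback (orbit_map a) w1)
                       (form_pullback (orbit_map a) w2),
      forall (k l : nat) (w1 : plotwise (orbit_diffeology a) k)
             (w2 : plotwise (orbit_diffeology a) l),
        dforms (orbit_diffeology a) k w1 -> dforms (orbit_diffeology a) l w2 ->
        form_pullback (orbit_map a) (form_wedge w1 w2) =
        form_wedge (form_pullback (orbit_map a) w1)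
                   (form_pullback (orbit_map a) w2) &
      forall (k : nat) (w : plotwise (orbit_diffeology a) k),
        dforms (orbit_diffeology a) k w ->
        form_pullback (orbit_map a) (form_d w) =
        form_d (form_pullback (orbit_map a) w)].
Proof.
split=> // k; split.
- move=> w wD; split; first exact: dforms_pullback.
    exact: pullback_invariant.
  exact: pullback_horizontal.
- move=> w1 w2 /set_mem w1D /set_mem w2D; exact: pullback_injective.
- move=> w wB; exists (descended_form w); first exact: descended_dform.
  exact: pullback_descended_form.
Qed.
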